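(* Let $n\geq 2$ and let $(M^n,\bar g)$ be an $n$-dimensional Riemannian manifold. For any $p\in M$ there exist $r_0>0$ and $\eta>0$ such that the following holds for every domain $\Omega\subset M$ with $p\in\Omega\subset B_{r_0}(p)$: if $g\in[\bar g]$ is a metric with $\mathrm{supp}(g-\bar g)\subset\Omega$ and $\|g-\bar g\|_{C^0(M,\bar g)}<\eta$, and $g$ satisfies either $$R_g\geq R_{\bar g}\ \text{ on } M \qquad\text{or}\qquad R_g\leq R_{\bar g}\ \text{ on } M,$$ then $g\equiv\bar g$ on $M$. In particular, if the diameter of $\Omega\ni p$ is sufficiently small, then $\bar g$ is an isolated solution (with respect to the $C^0(M,\bar g)$ norm) of the problem $$R_g=R_{\bar g},\qquad g\in[\bar g],\qquad \mathrm{supp}(g-\bar g)\subset\Omega.$$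
   Context: All metrics are smooth. $[\bar g]$ is the conformal class of $\bar g$, i.e. all metrics $e^{2f}\bar g$ with $f\in C^\infty(M)$. $R_g$ is the scalar curvature of $g$. $B_r(p)$ is the geodesic ball of radius $r$ about $p$ with respect to $\bar g$. A domain is a connected open set. $\|h\|_{C^0(M,\bar g)}=\sup_M|h|_{\bar g}$ with the tensor norm induced by $\bar g$. *)

(* Defs.v *)
From mathcomp Require Import all_boot all_order all_algebra.
From mathcomp Require Import all_classical all_reals all_analysis.

Set Implicit Arguments.
Unset Strict Implicit.
Unset Printing Implicit Defensive.

Import Order.TTheory GRing.Theory Num.Theory.
Import numFieldNormedType.Exports.

Local Open Scope classical_set_scope.
Local Open Scope ring_scope.

Section Calculus.
Context {R : realType} {n : nat}.

Definition pderiv (i : 'I_n) (f : 'rV[R]_n -> R) : 'rV[R]_n -> R :=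
  fun x => 'D_(delta_mx 0 i) f x.

(* C^oo on an open set [U]: iterated partial derivatives of all orders exist
   and are continuous at the points of [U]. *)
Definition smooth_on (U : set 'rV[R]_n) (f : 'rV[R]_n -> R) : Prop :=
  forall (s : seq 'I_n) (x : 'rV[R]_n), U x ->
    {for x, continuous (foldr pderiv f s)} /\
    forall i : 'I_n, derivable (foldr pderiv f s) x (delta_mx 0 i).

Definition jacobian (F : 'rV[R]_n -> 'rV[R]_n) (x : 'rV[R]_n) : 'M[R]_n :=
  \matrix_(k, i) pderiv i (fun y => F y 0 k) x.

Definition qform (A : 'M[R]_n) (v : 'rV[R]_n) : R := (v *m A *m v^T) 0 0.

(* Scalar curvature in R^n of a matrix-valued function [G], through
   Gamma^k_ij = 1/2 g^kl (d_i g_jl + d_j g_il - d_l g_ij),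
   Ric_ij = d_k Gamma^k_ij - d_j Gamma^k_ik
            + Gamma^k_kl Gamma^l_ij - Gamma^k_jl Gamma^l_ik. *)
Definition christoffel (G : 'rV[R]_n -> 'M[R]_n) (k i j : 'I_n)
    (x : 'rV[R]_n) : R :=
  2^-1 * \sum_l invmx (G x) k l *
    (pderiv i (fun y => G y j l) x + pderiv j (fun y => G y i l) x
     - pderiv l (fun y => G y i j) x).

Definition ricci (G : 'rV[R]_n -> 'M[R]_n) (i j : 'I_n) (x : 'rV[R]_n) : R :=
  \sum_k (pderiv k (christoffel G k i j) x - pderiv j (christoffel G k i k) x)
  + \sum_k \sum_l (christoffel G k k l x * christoffel G l i j x
                   - christoffel G k j l x * christoffel G l i k x).

Definition scalar_curvature_coord (G : 'rV[R]_n -> 'M[R]_n) (x : 'rV[R]_n)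
    : R :=
  \sum_i \sum_j invmx (G x) i j * ricci G i j x.

(* Norm of the (0,2)-tensor [H] in the inner product [A]:
   |H|^2 = A^ik A^jl H_ij H_kl. *)
Definition tensor_norm (A H : 'M[R]_n) : R :=
  Num.sqrt (\sum_i \sum_j \sum_k \sum_l
              invmx A i k * invmx A j l * H i j * H k l).

End Calculus.

(* A smooth n-manifold without boundary, given by an atlas indexed by [chart]:
   [phi c] is a homeomorphism of the open set [dom c] onto the open set
   [cod c] of R^n, with inverse [psi c]; values outside are irrelevant.
   Connectedness is not required. *)
Record smooth_manifold (R : realType) (n : nat) := SmoothManifold {
  carrier :> topologicalType;
  manifold_hausdorff : hausdorff_space carrier;
  manifold_countable : @second_countable carrier;
  chart : Type;
  dom : chart -> set carrier;
  cod : chart -> set 'rV[R]_n;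
  phi : chart -> carrier -> 'rV[R]_n;
  psi : chart -> 'rV[R]_n -> carrier;
  dom_open : forall c, open (dom c);
  cod_open : forall c, open (cod c);
  dom_cover : forall q, exists c, dom c q;
  phi_cod : forall c q, dom c q -> cod c (phi c q);
  psi_dom : forall c x, cod c x -> dom c (psi c x);
  phiK : forall c q, dom c q -> psi c (phi c q) = q;
  psiK : forall c x, cod c x -> phi c (psi c x) = x;
  phi_continuous : forall c q, dom c q -> {for q, continuous (phi c)};
  psi_continuous : forall c x, cod c x -> {for x, continuous (psi c)};
  transition_smooth : forall (c d : chart) (k : 'I_n),
    smooth_on (cod c `&` psi c @^-1` dom d) (fun x => phi d (psi c x) 0 k)
}.

Section Manifold.
Context {R : realType} {n : nat} {M : smooth_manifold R n}.

Definition smooth_function (f : M -> R) : Prop :=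
  forall c : chart M, smooth_on (cod c) (f \o psi c).

(* A (0,2)-tensor field: [T c q] is the matrix of components of the field at
   [q] in the chart [c]; it is meaningful only for [q] in [dom c]. *)
Local Notation tensor_field := (chart M -> M -> 'M[R]_n).

Record riemannian_metric := RiemannianMetric {
  metric_comp :> tensor_field;
  metric_transform : forall (c d : chart M) (q : M), dom c q -> dom d q ->
    let J := jacobian (fun x => phi d (psi c x)) (phi c q) in
    metric_comp c q = J^T *m metric_comp d q *m J;
  metric_smooth : forall (c : chart M) (i j : 'I_n),
    smooth_on (cod c) (fun x => metric_comp c (psi c x) i j);
  metric_sym : forall (c : chart M) (q : M), dom c q ->
    (metric_comp c q)^T = metric_comp c q;
  metric_pos : forall (c : chart M) (q : M) (v : 'rV[R]_n), dom c q ->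
    v != 0 -> 0 < qform (metric_comp c q) v
}.

Implicit Types g h : riemannian_metric.

Definition tensor_sub (S T : tensor_field) : tensor_field :=
  fun c q => S c q - T c q.

Definition tensor_eq (S T : tensor_field) : Prop :=
  forall (c : chart M) (q : M), dom c q -> S c q = T c q.

Definition tensor_support (T : tensor_field) : set M :=
  closure [set q | exists2 c : chart M, dom c q & T c q <> 0].

(* The value of |T|_g at [q] is the same in all charts around [q]. *)
Definition C0norm g (T : tensor_field) : \bar R :=
  ereal_sup [set z | exists (c : chart M) (q : M),
    dom c q /\ z = (tensor_norm (g c q) (T c q))%:E].

Definition conformal_class h : set riemannian_metric :=
  [set g | exists2 f : M -> R, smooth_function f &
    forall (c : chart M) (q : M), dom c q ->
      g c q = expR (2 * f q) *: h c q].

(* The expression of the function R_g in the chart [c], at the point [q] of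
   [dom c]; it does not depend on [c]. *)
Definition scalar_curvature g (c : chart M) (q : M) : R :=
  scalar_curvature_coord (fun x => g c (psi c x)) (phi c q).

Definition scalar_curvature_le g h : Prop :=
  forall (c : chart M) (q : M), dom c q ->
    scalar_curvature g c q <= scalar_curvature h c q.

Definition scalar_curvature_eq g h : Prop :=
  forall (c : chart M) (q : M), dom c q ->
    scalar_curvature g c q = scalar_curvature h c q.

(* Continuous on [0, 1], with a continuous derivative off a finite set [s]
   and one-sided limits of the derivative at all points. *)
Definition piecewise_C1 (gam : R -> M) : Prop :=
  {within `[0, 1], continuous gam} /\
  exists s : seq R, forall (t : R) (c : chart M),
    0 <= t <= 1 -> dom c (gam t) ->
    let u := phi c \o gam in
    [/\ 0 < t < 1 -> t \notin s ->
          derivable u t 1 /\ {for t, continuous (derive1 u)},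
        t < 1 -> cvg (derive1 u x @[x --> t^'+]) &
        0 < t -> cvg (derive1 u x @[x --> t^'-])].

(* |gam'(t)|_g: all charts around [gam t] give the same value when [gam] is
   differentiable at [t], and the supremum is this common value. *)
Definition speed g (gam : R -> M) (t : R) : \bar R :=
  ereal_sup [set z | exists2 c : chart M, dom c (gam t) &
    z = (Num.sqrt (qform (g c (gam t)) (derive1 (phi c \o gam) t)))%:E].

Definition curve_length g (gam : R -> M) : \bar R :=
  (\int[lebesgue_measure]_(t in `[0%R, 1%R]) speed g gam t)%E.

Definition distance g (x y : M) : \bar R :=
  ereal_inf [set l | exists gam : R -> M,
    [/\ piecewise_C1 gam, gam 0 = x, gam 1 = y & l = curve_length g gam]].

Definition geodesic_ball g (p : M) (r : R) : set M :=
  [set q | (distance g p q < r%:E)%E].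

Definition diameter g (A : set M) : \bar R :=
  ereal_sup [set z | exists x y : M, [/\ A x, A y & z = distance g x y]].

Definition domain (A : set M) : Prop := open A /\ connected A.

Definition isolated_in_C0 h (P : set riemannian_metric) : Prop :=
  P h /\ exists2 eta : R, 0 < eta &
    forall g, P g -> (C0norm h (tensor_sub g h) < eta%:E)%E -> tensor_eq g h.

Definition conformal_solution h (Omega : set M) : set riemannian_metric :=
  [set g | [/\ scalar_curvature_eq g h, conformal_class h g &
             tensor_support (tensor_sub g h) `<=` Omega]].

End Manifold.

Arguments riemannian_metric {R n} M.

(* Main.v *)
Require Import Defs.
From mathcomp Require Import all_boot all_order all_algebra.
From mathcomp Require Import all_classical all_reals all_analysis.
From mathcomp Require Import measurable_realfun ring lra.
Import Order.TTheory GRing.Theory Num.Theory.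
Import numFieldNormedType.Exports.
Local Open Scope classical_set_scope.
Local Open Scope ring_scope.

(* In a chart around [p], write [g = e^(2f) gbar]. The conformal change formula
   reads [R_g e^(2f) = R_gbar - 2(n-1) tr(gbar^-1 D^2 f) + E], where [E] collects
   the terms linear and quadratic in [df]; only bounds on [E] are needed. Hence
   either sign condition on [R_g - R_gbar] makes [h = f] or [h = -f] satisfy
   [tr(gbar^-1 D^2 h) <= C (|dh| + |dh|^2 + |h|)] as soon as [|f| <= 1], with [C]
   depending only on [gbar] near [p]. Moreover [h] vanishes outside a small
   coordinate ball, since geodesic balls of small radius lie in the chart.
   On a small ball, touching [h] from below by multiples of [1 - B |x|^2] gives
   [h >= 0]; if [h] did not vanish identically, then touching it from below near
   a sphere around a point where [h > 0], through a nearest zero of [h], would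
   contradict the inequality again (Hopf's argument). Ellipticity is used in the
   form [tr (A H) >= 0] for [A] positive definite and [H] a Hessian at a minimum. *)

Set Implicit Arguments.
Unset Strict Implicit.
Unset Printing Implicit Defensive.

(** * Functions of class C1 and C2 *)

(** The zeroth-order term [C |h|] has no favourable sign, so on a large set the maximum principle
    may fail. Smallness of the support replaces the sign: on a tiny ball a paraboloid with large
    opening [B] is nearly constant and has a small gradient, yet its second-order term is of size
    [B]. The quadratic gradient term is not homogeneous in [h]; the bound [|h| <= 1] makes it linear
    in the size of the barrier. C0 closeness supplies this bound and the estimate of [e^(2f) - 1] by
    [|f|], so [eta] can be the absolute constant 1/2 and only the radius depends on [gbar]. In
    Hopf's argument the barrier is used on both sides of the sphere. Contact is then a local minimum
    in an open set, and the second-derivative test replaces the sign of a normal derivative at the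
    boundary. *)

Section C1.
Context {R : realType} {n : nat}.
Implicit Types (f g : 'rV[R]_n -> R) (U : set 'rV[R]_n) (x v w : 'rV[R]_n).

Definition C1 U f := forall x, U x -> {for x, continuous f} /\
  forall i, derivable f x (delta_mx 0 i) /\ {for x, continuous (pderiv i f)}.

Definition C2 U f := C1 U f /\ forall i, C1 U (pderiv i f).

Lemma near_eq_continuous_at f g x :
  (\near x, f x = g x) -> {for x, continuous f} -> {for x, continuous g}.
Proof.
move=> fg cf; have gx := nbhs_singleton fg.
rewrite /prop_for /continuous_at -gx; apply: cvg_trans cf.
exact: (near_eq_cvg fg).
Qed.

Lemma continuous_at_add f g x : {for x, continuous f} -> {for x, continuous g} ->
  {for x, continuous (fun y => f y + g y)}.
Proof. by move=> cf cg; exact: (cvgD cf cg). Qed.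

Lemma continuous_at_opp f x : {for x, continuous f} ->
  {for x, continuous (fun y => - f y)}.
Proof. by move=> cf; exact: (cvgN cf). Qed.

Lemma continuous_at_mul f g x : {for x, continuous f} -> {for x, continuous g} ->
  {for x, continuous (fun y => f y * g y)}.
Proof. by move=> cf cg; exact: (cvgM cf cg). Qed.

Lemma continuous_at_inv f x : f x != 0 -> {for x, continuous f} ->
  {for x, continuous (fun y => (f y)^-1)}.
Proof. by move=> f0 cf; exact: (cvgV f0 cf). Qed.

Lemma continuous_at_sum I (r : seq I) (P : pred I) (F : I -> 'rV[R]_n -> R) x :
  (forall i, P i -> {for x, continuous (F i)}) ->
  {for x, continuous (fun y => \sum_(i <- r | P i) F i y)}.
Proof.
move=> cF; elim: r => [|i r IH].
  have -> : (fun y => \sum_(i <- [::] | P i) F i y) = fun=> 0.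
    by apply/funext => y; rewrite big_nil.
  exact: cst_continuous.
have -> : (fun y => \sum_(i <- i :: r | P i) F i y) =
    (if P i then fun y => F i y + \sum_(i <- r | P i) F i y
     else fun y => \sum_(i <- r | P i) F i y).
  by apply/funext => y; rewrite big_cons; case: ifP.
by case: ifP => // Pi; apply: continuous_at_add => //; exact: cF.
Qed.

(** [pderiv] takes a default value where the limit does not exist, so its continuity is transferred
    from the candidate [d]; openness of [U] makes the two agree near each point of [U]. *)
Lemma C1_is_derive U f (d : 'I_n -> 'rV[R]_n -> R) : open U ->
  (forall x, U x -> {for x, continuous f}) ->
  (forall x i, U x -> is_derive x (delta_mx 0 i) f (d i x)) ->
  (forall x i, U x -> {for x, continuous (d i)}) -> C1 U f.
Proof.
move=> oU cf fd cd x Ux; split; first exact: cf.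
move=> i; split; first by have [] := fd x i Ux.
apply: near_eq_continuous_at (cd x i Ux).
near=> y; have Uy : U y by near: y; exact: open_nbhs_nbhs.
by have [_ <-] := fd y i Uy.
Unshelve. all: by end_near. Qed.

Lemma C1_pderiv U f x i : C1 U f -> U x ->
  is_derive x (delta_mx 0 i) f (pderiv i f x).
Proof. by move=> cf Ux; apply/derivableP; have [_ /(_ i)[]] := cf x Ux. Qed.

Lemma pderivE x i f d : is_derive x (delta_mx 0 i) f d -> pderiv i f x = d.
Proof. by case. Qed.

Lemma C1_continuous U f x : C1 U f -> U x -> {for x, continuous f}.
Proof. by move=> cf /cf[]. Qed.

Lemma C1_pderiv_continuous U f x i : C1 U f -> U x ->
  {for x, continuous (pderiv i f)}.
Proof. by move=> cf /cf[_ /(_ i)[]]. Qed.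

Lemma eq_pderiv U f g x i : open U -> (forall y, U y -> f y = g y) -> U x ->
  pderiv i f x = pderiv i g x.
Proof.
move=> oU fg Ux; apply: near_eq_derive.
near=> y; apply: fg; near: y; exact: open_nbhs_nbhs.
Unshelve. all: by end_near. Qed.

Lemma eq_C1 U f g : open U -> (forall y, U y -> f y = g y) -> C1 U f -> C1 U g.
Proof.
move=> oU fg cf; have nfg x : U x -> \near x, f x = g x.
  by move=> Ux; near=> y; apply: fg; near: y; exact: open_nbhs_nbhs.
apply: (@C1_is_derive _ _ (fun i => pderiv i f)) => //.
- by move=> x Ux; apply: near_eq_continuous_at (nfg x Ux) (C1_continuous cf Ux).
- by move=> x i Ux; apply: near_eq_is_derive (nfg x Ux) (C1_pderiv i cf Ux).
- by move=> x i; exact: C1_pderiv_continuous.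
Unshelve. all: by end_near. Qed.

Lemma C1_cst U (c : R) : open U -> C1 U (fun=> c).
Proof.
move=> oU; apply: (@C1_is_derive _ _ (fun _ _ => 0)) => // *; exact: cst_continuous.
Qed.

Lemma C1_coord U i : open U -> C1 U (fun x => x 0 i).
Proof.
move=> oU; apply: (@C1_is_derive _ _ (fun j _ => (delta_mx 0 j : 'rV[R]_n) 0 i)) => //.
- by move=> x _; exact: coord_continuous.
- move=> x j _; apply: DeriveDef; first exact/diff_derivable/differentiable_coord.
  have := @derive_mx R 'rV[R]_n 1 n id x (delta_mx 0 j) (@derivable_id _ _ _ _).
  by rewrite derive_id => /matrixP/(_ 0 i); rewrite [RHS]mxE.
- by move=> *; exact: cst_continuous.
Qed.

Lemma C1D U f g : open U -> C1 U f -> C1 U g -> C1 U (fun x => f x + g x).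
Proof.
move=> oU cf cg.
apply: (@C1_is_derive _ _ (fun i x => pderiv i f x + pderiv i g x)) => //.
- by move=> x Ux; apply: continuous_at_add; exact: C1_continuous Ux.
- by move=> x i Ux; have ? := C1_pderiv i cf Ux; have ? := C1_pderiv i cg Ux;
    exact: is_deriveD.
- by move=> x i Ux; apply: continuous_at_add; exact: C1_pderiv_continuous Ux.
Qed.

Lemma C1N U f : open U -> C1 U f -> C1 U (fun x => - f x).
Proof.
move=> oU cf.
apply: (@C1_is_derive _ _ (fun i x => - pderiv i f x)) => //.
- by move=> x Ux; apply: continuous_at_opp; exact: C1_continuous Ux.
- by move=> x i Ux; have ? := C1_pderiv i cf Ux; exact: is_deriveN.
- by move=> x i Ux; apply: continuous_at_opp; exact: C1_pderiv_continuous Ux.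
Qed.

Lemma C1B U f g : open U -> C1 U f -> C1 U g -> C1 U (fun x => f x - g x).
Proof. by move=> oU cf cg; apply: C1D => //; exact: C1N. Qed.

Lemma is_derive_mul f g x v a b : is_derive x v f a -> is_derive x v g b ->
  is_derive x v (fun y => f y * g y) (f x * b + g x * a).
Proof. by move=> fa gb; exact: is_deriveM. Qed.

Lemma is_derive_add f g x v a b : is_derive x v f a -> is_derive x v g b ->
  is_derive x v (fun y => f y + g y) (a + b).
Proof. by move=> fa gb; exact: is_deriveD. Qed.

Lemma is_derive_const (c : R) x v : is_derive x v (fun=> c) 0.
Proof. exact: is_derive_cst. Qed.

Lemma C1M U f g : open U -> C1 U f -> C1 U g -> C1 U (fun x => f x * g x).
Proof.
move=> oU cf cg.
apply: (@C1_is_derive _ _ (fun i x => f x * pderiv i g x + g x * pderiv i f x)) => //.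
- by move=> x Ux; apply: continuous_at_mul; exact: C1_continuous Ux.
- by move=> x i Ux; apply: is_derive_mul; apply: C1_pderiv Ux. 
- move=> x i Ux; have ? := C1_continuous cf Ux; have ? := C1_continuous cg Ux.
  by apply: continuous_at_add; apply: continuous_at_mul => //;
    exact: C1_pderiv_continuous Ux.
Qed.

Lemma C1V U f : open U -> (forall x, U x -> f x != 0) -> C1 U f ->
  C1 U (fun x => (f x)^-1).
Proof.
move=> oU f0 cf.
apply: (@C1_is_derive _ _ (fun i x => - ((f x)^-1 * (f x)^-1) * pderiv i f x)) => //.
- by move=> x Ux; apply: continuous_at_inv; [exact: f0|exact: C1_continuous Ux].
- move=> x i Ux; have [df _] := C1_pderiv i cf Ux.
  apply: DeriveDef; first exact: derivableV (f0 _ Ux) df.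
  by rewrite deriveV ?f0// /GRing.scale/= expr2 invfM.
- move=> x i Ux; have cV : {for x, continuous (fun x => (f x)^-1)}.
    by apply: continuous_at_inv; [exact: f0|exact: C1_continuous Ux].
  apply: continuous_at_mul; last exact: C1_pderiv_continuous Ux.
  by apply: continuous_at_opp; exact: continuous_at_mul.
Qed.

Lemma C1_sum U I (r : seq I) (P : pred I) (F : I -> 'rV[R]_n -> R) : open U ->
  (forall i, P i -> C1 U (F i)) -> C1 U (fun x => \sum_(i <- r | P i) F i x).
Proof.
move=> oU cF; elim: r => [|i r IH].
  by apply: eq_C1 (C1_cst (0 : R) oU) => // y _; rewrite big_nil.
have [Pi|/negbTE Pi] := boolP (P i).
  by apply: eq_C1 (C1D oU (cF i Pi) IH) => // y _; rewrite big_cons Pi.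
by apply: eq_C1 IH => // y _; rewrite big_cons Pi.
Qed.

Lemma C1_prod U I (r : seq I) (P : pred I) (F : I -> 'rV[R]_n -> R) : open U ->
  (forall i, P i -> C1 U (F i)) -> C1 U (fun x => \prod_(i <- r | P i) F i x).
Proof.
move=> oU cF; elim: r => [|i r IH].
  by apply: eq_C1 (C1_cst (1 : R) oU) => // y _; rewrite big_nil.
have [Pi|/negbTE Pi] := boolP (P i).
  by apply: eq_C1 (C1M oU (cF i Pi) IH) => // y _; rewrite big_cons Pi.
by apply: eq_C1 IH => // y _; rewrite big_cons Pi.
Qed.

Lemma C1_det U m (A : 'rV[R]_n -> 'M[R]_m) : open U ->
  (forall i j, C1 U (fun x => A x i j)) -> C1 U (fun x => \det (A x)).
Proof.
move=> oU cA; apply: C1_sum => // s _; apply: C1M => //; first exact: C1_cst.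
by apply: C1_prod.
Qed.

(** By Cramer's rule the entries of the inverse are cofactors divided by the determinant. *)
Lemma C1_invmx U m (A : 'rV[R]_n -> 'M[R]_m) i j : open U ->
  (forall x, U x -> A x \in unitmx) ->
  (forall i j, C1 U (fun x => A x i j)) -> C1 U (fun x => invmx (A x) i j).
Proof.
move=> oU uA cA.
have cV : C1 U (fun x => (\det (A x))^-1 * (\adj (A x)) i j).
  apply: C1M => //.
    apply: C1V => //; last exact: C1_det.
    by move=> x /uA; rewrite unitmxE unitfE.
  have : C1 U (fun x => (-1) ^+ (j + i) * \det (row' j (col' i (A x)))).
    apply: C1M => //; first exact: C1_cst.
    apply: C1_det => // k l.
    by apply: eq_C1 (cA (lift j k) (lift i l)) => // y _; rewrite !mxE.
  by apply: eq_C1 => // y _; rewrite mxE.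
apply: eq_C1 cV => // y /uA Ay; rewrite /invmx Ay [in RHS]mxE; exact: erefl.
Qed.

Lemma is_derive_bigsum I (r : seq I) (P : pred I) (F : I -> 'rV[R]_n -> R)
    (d : I -> R) x v : (forall i, P i -> is_derive x v (F i) (d i)) ->
  is_derive x v (fun y => \sum_(i <- r | P i) F i y) (\sum_(i <- r | P i) d i).
Proof.
move=> Fd; elim: r => [|i r IH].
  rewrite big_nil; under eq_fun do rewrite big_nil.
  exact: is_derive_cst.
rewrite big_cons; under eq_fun do rewrite big_cons.
by case: ifP => // Pi; have di := Fd i Pi; exact: (is_deriveD di IH).
Qed.

(** The two difference quotients are the same function of the increment, so one-variable calculus
    applies along every line. *)
Lemma is_derive_lineP f x v (t : R) d :
  is_derive (t *: v + x) v f d <-> is_derive t 1 (fun s : R => f (s *: v + x)) d.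
Proof.
have E : (fun h => h^-1 *: ((f \o shift (t *: v + x)) (h *: v) - f (t *: v + x)))
  = (fun h => h^-1 *: (((fun s => f (s *: v + x)) \o shift t) (h *: 1)
               - f (t *: v + x))).
  by apply/funext => h /=; rewrite [h%:A]mulr1 scalerDl addrA.
by split=> -[dx <-]; apply: DeriveDef; move: dx; rewrite /derivable /derive E.
Qed.

Lemma is_derive_expR_comp f x v d : is_derive x v f d ->
  is_derive x v (fun y => expR (f y)) (expR (f x) * d).
Proof.
have -> : x = 0 *: v + x by rewrite scale0r add0r.
move=> /is_derive_lineP df; apply/is_derive_lineP.
have de : is_derive (f (0 *: v + x)) 1 expR (expR (f (0 *: v + x))).
  exact: is_derive_expR.
by have := @is_derive1_comp _ _ (fun s => f (s *: v + x)) _ _ _ de df.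
Qed.

Lemma is_derive_scalev f x v d (c : R) : is_derive x v f d ->
  is_derive x (c *: v) f (c * d).
Proof.
have -> : x = 0 *: v + x by rewrite scale0r add0r.
move=> fd; have {}fd : is_derive ((0 * c) *: v + x) v f d by rewrite mul0r.
have -> : 0 *: v + x = 0 *: (c *: v) + x by rewrite !scale0r.
apply/is_derive_lineP.
have -> : (fun s => f (s *: (c *: v) + x)) = (fun s => f (s *: v + x)) \o ( *%R^~ c).
  by apply/funext => s /=; rewrite scalerA.
rewrite mulrC; apply: is_derive1_comp; first by apply/is_derive_lineP.
have -> : ( *%R^~ c) = (fun s : R => s * c) by [].
have -> : (fun s : R => s * c) = (c \*: id) by apply/funext => s /=; rewrite mulrC.
by apply: is_derive_eq; rewrite [LHS]mulr1.
Qed.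

Lemma mean_value_line f (d : 'rV[R]_n -> R) x v (h : R) :
  (forall t : R, `|t| <= `|h| -> is_derive (t *: v + x) v f (d (t *: v + x))) ->
  exists2 t : R, `|t| <= `|h| & f (h *: v + x) - f x = h * d (t *: v + x).
Proof.
move=> fd; pose g (t : R) := f (t *: v + x).
have gd (t : R) : `|t| <= `|h| -> is_derive t 1 g (d (t *: v + x)).
  by move=> /fd /is_derive_lineP.
have gc a b : (forall t, t \in `[a, b] -> `|t| <= `|h|) ->
    {within `[a, b], continuous g}.
  move=> ab; apply: derivable_within_continuous => t /ab th.
  by have [] := gd t th.
have g0 : g 0 = f x by rewrite /g scale0r add0r.
have [h0|h0] := leP 0 h.
  have H t : t \in `[0, h] -> `|t| <= `|h|.
    by rewrite in_itv/= => /andP[t0 th]; rewrite !ger0_norm.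
  have [|t th E] := @MVT_segment R g (fun t => d (t *: v + x)) 0 h h0 _ (gc _ _ H).
    by move=> t th; apply: gd; apply: H; exact: subset_itv_oo_cc th.
  by exists t; [exact: H|rewrite -/(g h) -g0 E subr0 mulrC].
have H t : t \in `[h, 0] -> `|t| <= `|h|.
  by rewrite in_itv/= => /andP[th t0]; rewrite !ler0_norm ?lerN2 // ltW.
have [|t th E] := @MVT_segment R g (fun t => d (t *: v + x)) h 0 (ltW h0) _ (gc _ _ H).
  by move=> t th; apply: gd; apply: H; exact: subset_itv_oo_cc th.
exists t; first exact: H.
by rewrite -/(g h) -g0 -opprB E sub0r mulrN opprK mulrC.
Qed.

(* Additivity in the direction needs continuity of only one of the two
   directional derivatives: move along [w] first and apply the mean value
   theorem along [v]. *)
Lemma is_derive_addv f (d : 'rV[R]_n -> R) x v w e :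
  (\forall y \near x, is_derive y v f (d y)) -> {for x, continuous d} ->
  is_derive x w f e -> is_derive x (v + w) f (d x + e).
Proof.
move=> fd cd [dw <-].
suff H : (fun h => h^-1 *: ((f \o shift x) (h *: (v + w)) - f x)) @ 0^'
    --> d x + 'D_w f x.
  by apply: DeriveDef; [apply/cvg_ex; eexists; exact: H|exact: cvg_lim H].
have -> : (fun h => h^-1 *: ((f \o shift x) (h *: (v + w)) - f x)) =
    (fun h => h^-1 *: (f (h *: v + (h *: w + x)) - f (h *: w + x)) +
              h^-1 *: ((f \o shift x) (h *: w) - f x)).
  by apply/funext => h /=; rewrite -[RHS]scalerDr subrKA [h *: (v + w)]scalerDr addrA.
suff dv : h^-1 *: (f (h *: v + (h *: w + x)) - f (h *: w + x)) @[h --> 0^'] --> d x.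
  exact: (cvgD dv dw).
apply/cvgrPdist_le => /= eps eps0.
have /nbhs_ballP[r /= r0 rP] : \forall y \near x,
    is_derive y v f (d y) /\ `|d x - d y| <= eps.
  have cde : \forall y \near x, `|d x - d y| <= eps.
    by move/(cvgrPdist_le (FF := nbhs_filter x)) : cd => /(_ _ eps0).
  by apply: filterS2 fd cde => y.
(* The points [t *: v + h *: w] with [|t| <= |h|] have norm at most [|h| * K]; the summand 1 keeps
   [K] positive when both directions vanish. *)
pose K := `|v| + `|w| + 1.
have K0 : 0 < K by rewrite ltr_wpDl ?addr_ge0.
near=> h.
have hr : `|h| * K < r.
  rewrite -ltr_pdivlMr//; near: h; apply: dnbhs0_lt; exact: divr_gt0.
have hn0 : h != 0 by near: h; exact: nbhs_dnbhs_neq.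
have inr t : `|t| <= `|h| -> ball x r (t *: v + (h *: w + x)).
  move=> th; rewrite -ball_normE /= addrA opprD addrCA subrr addr0 normrN.
  apply: le_lt_trans hr; apply: le_trans (ler_normD _ _) _.
  rewrite !normrZ !mulrDr mulr1.
  by rewrite ler_wpDr// lerD2r ler_wpM2r.
have [|t th ->] := @mean_value_line f d (h *: w + x) v h.
  by move=> t /inr/rP[].
rewrite [_ *: _]mulrA mulVf// mul1r.
by have [] := rP _ (inr t th).
Unshelve. all: by end_near. Qed.

(** The components of [v] are added one at a time. The partial sum already treated has a derivative
    near [x] that is continuous at [x], which is what [is_derive_addv] asks of its first
    direction. *)
Lemma C1_derive U f x v : open U -> C1 U f -> U x ->
  is_derive x v f (\sum_i v 0 i * pderiv i f x).
Proof.
move=> oU cf Ux.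
rewrite [in is_derive _ v](row_sum_delta v).
elim: (index_enum 'I_n) x Ux => [|i r IH] x Ux.
  rewrite !big_nil; exact: is_derive0.
rewrite !big_cons addrC [X in is_derive _ _ _ X]addrC.
apply: (@is_derive_addv f (fun y => \sum_(j <- r) v 0 j * pderiv j f y)).
- by near=> y; apply: IH; near: y; exact: open_nbhs_nbhs.
- apply: continuous_at_sum => j _; apply: continuous_at_mul.
    exact: cst_continuous.
  exact: C1_pderiv_continuous Ux.
- by apply: is_derive_scalev; exact: C1_pderiv Ux.
Unshelve. all: by end_near. Qed.

Lemma is_derive_local_min f x v d e : 0 < e ->
  (forall t : R, `|t| < e -> derivable f (t *: v + x) v) ->
  (forall t : R, `|t| < e -> f x <= f (t *: v + x)) ->
  is_derive x v f d -> d = 0.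
Proof.
move=> e0 fd fmin df.
pose g (t : R) := f (t *: v + x).
have inI t : t \in `](- e), e[ -> `|t| < e by rewrite in_itv/= ltr_norml.
have gd : is_derive (0 : R) 1 g d by apply/is_derive_lineP; rewrite scale0r add0r.
have gmin : is_derive (0 : R) 1 g 0.
  apply: (@derive1_at_min R g (- e) e).
  - by rewrite ge0_cp ?ltW.
  - by move=> t /inI te; have /derivableP/is_derive_lineP[] := fd t te.
  - by rewrite in_itv/= oppr_lt0 e0.
  - by move=> t /inI/fmin; rewrite /g scale0r add0r.
by have [_ <-] := gd; have [_] := gmin.
Qed.

Lemma C2_local_min U u x : open U -> C2 U u -> U x ->
  (\forall y \near x, u x <= u y) ->
  (forall i, pderiv i u x = 0) /\
  forall v : 'rV[R]_n, 0 <= \sum_i \sum_j v 0 i * v 0 j * pderiv i (pderiv j u) x.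
Proof.
move=> oU [c1 c2] Ux umin.
have key v : exists2 e, 0 < e &
    forall t, `|t| < e -> U (t *: v + x) /\ u x <= u (t *: v + x).
  have /nbhs_ballP[r /= r0 rP] : \forall y \near x, U y /\ u x <= u y.
    by near=> y; split; near: y => //; exact: open_nbhs_nbhs.
  exists (r / (`|v| + 1)) => [|t tr].
    by rewrite divr_gt0// ltr_wpDl.
  apply: rP; rewrite -ball_normE/= opprD addrCA subrr addr0 normrN normrZ.
  move: tr; rewrite ltr_pdivlMr ?ltr_wpDl//; apply: le_lt_trans.
  by rewrite ler_wpM2l// lerDl.
pose w v y := \sum_j v 0 j * pderiv j u y.
have uw v y : U y -> is_derive y v u (w v y) by exact: C1_derive.
have w0 v : w v x = 0.
  have [e e0 eP] := key v; apply: is_derive_local_min e0 _ _ (uw v x Ux).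
    by move=> t /eP[/(uw v)[]].
  by move=> t /eP[].
split=> [i|v].
  have := w0 (delta_mx 0 i); rewrite /w (bigD1 i)//= mxE !eqxx mul1r big1 ?addr0//.
  by move=> j /negbTE ji; rewrite mxE ji andbF mul0r.
(* [L] is the derivative along [v] of [w v], which vanishes at [x]. If [L < 0], then [w v] is
   negative shortly after [x], and the mean value theorem takes [u] below its minimum. *)
rewrite leNgt; apply/negP; set L := (X in X < 0) => L0.
have wL : is_derive x v (w v) L.
  have -> : L = \sum_j v 0 j * \sum_i v 0 i * pderiv i (pderiv j u) x.
    rewrite /L exchange_big/=; apply: eq_bigr => j _; rewrite mulr_sumr.
    by apply: eq_bigr => i _; rewrite mulrA (mulrC (v 0 i)).
  apply: is_derive_bigsum => j _.
  have d1 := C1_derive v oU (c2 j) Ux.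
  have := is_derive_mul (is_derive_cst (v 0 j) x v) d1.
  by rewrite mulr0 addr0.
have [e e0 eP] := key v.
have wneg : \forall t \near 0^', (t^-1 *: ((w v \o shift x) (t *: v) - w v x)) < 0.
  have [dw wE] := wL; rewrite -wE in L0.
  by have := cvgr_lt _ dw _ L0; apply.
have [d /= d0 dP] := wneg.
pose t := Num.min d e / 2.
have m0 : 0 < Num.min d e by rewrite lt_min d0 e0.
have t0 : 0 < t by rewrite divr_gt0.
have tm : t < Num.min d e by rewrite ltr_pdivrMr// ltr_pMr// ltr1n.
have te : t < e by apply: lt_le_trans tm _; rewrite ge_min lexx orbT.
have td : t < d by apply: lt_le_trans tm _; rewrite ge_min lexx.
have itve s : s \in `[0, t] -> `|s| < e.
  by rewrite in_itv/= => /andP[s0 st]; rewrite ger0_norm//; exact: le_lt_trans te.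
have [||s st E] := @MVT R (fun s => u (s *: v + x)) (fun s => w v (s *: v + x)) 0 t t0.
- by move=> s /subset_itv_oo_cc/itve/eP[Us _]; apply/is_derive_lineP; exact: uw.
- apply: derivable_within_continuous => s /itve/eP[Us _].
  by have /is_derive_lineP[] := uw v _ Us.
have := (eP t _).2; rewrite gtr0_norm// => /(_ te).
rewrite -subr_ge0; move: E; rewrite scale0r add0r subr0 => ->.
move: st; rewrite in_itv/= => /andP[s0 st].
have := dP s; rewrite /= sub0r normrN gtr0_norm// => /(_ (lt_trans st td)).
rewrite w0 subr0 gt_eqF// => /(_ isT).
rewrite [X in X < 0](_ : _ = s^-1 * w v (s *: v + x))//.
rewrite pmulr_rlt0 ?invr_gt0// => ws; rewrite pmulr_lge0//.
by rewrite leNgt ws.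
Unshelve. all: by end_near. Qed.

End C1.

(** * Positive definite matrices *)

Section PositiveDefinite.
Context {R : realType}.

Lemma qformE n (A : 'M[R]_n) (v : 'rV[R]_n) :
  qform A v = \sum_i \sum_j v 0 i * v 0 j * A i j.
Proof.
rewrite /qform mxE exchange_big/=; apply: eq_bigr => j _.
rewrite !mxE mulr_suml; apply: eq_bigr => i _; ring.
Qed.

(* Completing the square in the first variable reduces to the Schur
   complement. *)
Lemma sum_posdef_mul_psd_ge0 n (A H : 'I_n -> 'I_n -> R) :
  (forall i j, A i j = A j i) ->
  (forall v : 'I_n -> R, (exists i, v i != 0) ->
    0 < \sum_i \sum_j v i * v j * A i j) ->
  (forall v : 'I_n -> R, 0 <= \sum_i \sum_j v i * v j * H i j) ->
  0 <= \sum_i \sum_j A i j * H i j.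
Proof.
elim: n A H => [|n IH] A H sA pA pH; first by rewrite big_ord0.
have a0 : 0 < A ord0 ord0.
  have /pA : exists i, (fun i : 'I_n.+1 => (i == ord0)%:R : R) i != 0.
    by exists ord0; rewrite eqxx oner_eq0.
  rewrite (bigD1 ord0)//= [X in _ < _ + X]big1 => [|i /negbTE i0]; last first.
    by rewrite big1// => j _; rewrite i0 !mul0r.
  rewrite (bigD1 ord0)//= [X in _ < _ + X + _]big1 => [|j /negbTE j0]; last first.
    by rewrite j0 mulr0 mul0r.
  by rewrite ?eqxx !mul1r !addr0.
set a := A ord0 ord0 in a0; have an0 : a != 0 by rewrite gt_eqF.
pose b i := A ord0 (lift ord0 i).
pose S i j := A (lift ord0 i) (lift ord0 j) - a^-1 * (b i * b j).
pose H' i j := H (lift ord0 i) (lift ord0 j).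
have S0 : 0 <= \sum_i \sum_j S i j * H' i j.
  apply: IH.
  - by move=> i j; rewrite /S sA (mulrC (b i)).
  - move=> w [i0 wi0]; pose beta := \sum_j w j * b j.
    (* The new first coordinate minimizes the form of [A] over all extensions of [w]; the minimum is
       the Schur complement at [w]. *)
    pose v i := if unlift ord0 i is Some j then w j else - (a^-1 * beta).
    have v0 : v ord0 = - (a^-1 * beta) by rewrite /v unlift_none.
    have vl j : v (lift ord0 j) = w j by rewrite /v liftK.
    have -> : \sum_i \sum_j w i * w j * S i j = \sum_i \sum_j v i * v j * A i j.
      have bE : a^-1 * beta * beta = \sum_j a^-1 * beta * (w j * b j).
        by rewrite -mulr_sumr.
      have E0 : \sum_j v ord0 * v j * A ord0 j =
          a^-1 * beta * (a^-1 * beta) * a - a^-1 * beta * beta.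
        rewrite big_ord_recl v0 -/a bE -sumrN.
        congr (_ + _); first by ring.
        by apply: eq_bigr => j _; rewrite vl -/(b j); ring.
      have E1 : \sum_(i < n) \sum_j v (lift ord0 i) * v j * A (lift ord0 i) j =
          \sum_i \sum_j w i * w j * A (lift ord0 i) (lift ord0 j) - a^-1 * beta * beta.
        rewrite bE -sumrB; apply: eq_bigr => i _.
        rewrite big_ord_recl v0 vl sA -/(b i) addrC; congr (_ + _); last by ring.
        by apply: eq_bigr => j _; rewrite vl.
      rewrite [in RHS]big_ord_recl E0 E1.
      have -> : \sum_i \sum_j w i * w j * S i j =
          \sum_i \sum_j w i * w j * A (lift ord0 i) (lift ord0 j)
          - a^-1 * (beta * beta).
        rewrite {1}/beta mulr_suml mulr_sumr -sumrB; apply: eq_bigr => i _.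
        rewrite /beta mulr_sumr mulr_sumr -sumrB; apply: eq_bigr => j _.
        rewrite /S; ring.
      by field.
    by apply: pA; exists (lift ord0 i0); rewrite vl.
  - move=> w; pose v i := if unlift ord0 i is Some j then w j else 0.
    have v0 : v ord0 = 0 by rewrite /v unlift_none.
    have vl j : v (lift ord0 j) = w j by rewrite /v liftK.
    have := pH v; rewrite big_ord_recl big1 ?add0r; last first.
      by move=> j _; rewrite v0 !mul0r.
    under eq_bigr => i _ do rewrite big_ord_recl v0 mulr0 mul0r add0r vl.
    by under eq_bigr => i _ do under eq_bigr => j _ do rewrite vl.
(* The rank-one part of [A] pairs with [H] to a value of the form of [H] times [a^-1]; what is left
   of [A] is the Schur complement on the last [n] indices. *)
suff -> : \sum_i \sum_j A i j * H i j =
   a^-1 * (\sum_i \sum_j A ord0 i * A ord0 j * H i j) +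
   \sum_i \sum_j S i j * H' i j.
  by rewrite addr_ge0// mulr_ge0// invr_ge0 ltW.
rewrite [in LHS]big_ord_recl/= [X in _ = a^-1 * X + _]big_ord_recl/= mulrDr.
rewrite -addrA; congr (_ + _).
  by rewrite mulr_sumr; apply: eq_bigr => j _; rewrite -/a; field.
rewrite mulr_sumr -big_split/=; apply: eq_bigr => i _.
rewrite [in LHS]big_ord_recl/= [X in _ = a^-1 * X + _]big_ord_recl/= mulrDr.
rewrite -addrA; congr (_ + _).
  by rewrite sA -/a; field.
rewrite mulr_sumr -big_split/=; apply: eq_bigr => j _.
by rewrite /S /H' /b; field.
Qed.

Context {n : nat}.
Implicit Types (A : 'M[R]_n) (v w : 'rV[R]_n).

Definition posdef A := A^T = A /\ forall v, v != 0 -> 0 < qform A v.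

(** The norm of ['rV[R]_n] is the maximum norm; the squared Euclidean norm is a polynomial and
    defines the coordinate balls used below. *)
Definition sqnorm v : R := \sum_i v 0 i ^+ 2.

Lemma sqnorm_ge0 v : 0 <= sqnorm v.
Proof. by apply: sumr_ge0 => i _; exact: sqr_ge0. Qed.

Lemma sqnorm_gt0 v : v != 0 -> 0 < sqnorm v.
Proof.
move=> v0; rewrite lt0r sqnorm_ge0 andbT; apply: contra v0 => /eqP.
move/psumr_eq0P => H; apply/eqP/rowP => i; rewrite mxE; apply/eqP.
by rewrite -sqrf_eq0 H// => j _; exact: sqr_ge0.
Qed.

Lemma sqr_coord_le_sqnorm v i : v 0 i ^+ 2 <= sqnorm v.
Proof.
by rewrite /sqnorm (bigD1 i)//= lerDl sumr_ge0// => j _; exact: sqr_ge0.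
Qed.

Lemma sqnormE v : sqnorm v = (v *m v^T) 0 0.
Proof. by rewrite mxE; apply: eq_bigr => i _; rewrite mxE expr2. Qed.

Lemma posdef_unitmx A : posdef A -> A \in unitmx.
Proof.
move=> [_ pA]; rewrite unitmxE unitfE; apply/negP => /det0P[v v0 vA].
by have := pA v v0; rewrite /qform vA mul0mx mxE ltxx.
Qed.

Lemma qform_invmx A v : posdef A -> qform (invmx A) v = qform A (v *m invmx A).
Proof.
move=> pA; rewrite /qform trmx_mul trmx_inv pA.1.
by rewrite mulmxKV ?posdef_unitmx// mulmxA.
Qed.

Lemma posdef_invmx A : posdef A -> posdef (invmx A).
Proof.
move=> pA; split=> [|v v0]; first by rewrite trmx_inv pA.1.
rewrite qform_invmx//; apply: pA.2; apply: contra v0 => /eqP v0.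
by rewrite -(mulmxKV (posdef_unitmx pA) v) v0 mul0mx.
Qed.

Lemma qform_le_entries A v K : (forall i j, `|A i j| <= K) ->
  qform A v <= K * n%:R * sqnorm v.
Proof.
move=> AK; rewrite qformE.
have E : \sum_i \sum_j (v 0 i ^+ 2 + v 0 j ^+ 2) = 2 * n%:R * sqnorm v.
  under eq_bigr => i _ do rewrite big_split/= sumr_const card_ord.
  rewrite big_split/= sumr_const card_ord sumrMnl -/(sqnorm v).
  by rewrite -[sqnorm v *+ n]mulr_natl; ring.
apply: (@le_trans _ _ (\sum_i \sum_j K / 2 * (v 0 i ^+ 2 + v 0 j ^+ 2))).
  apply: ler_sum => i _; apply: ler_sum => j _.
  have K0 : 0 <= K by exact: le_trans (AK i j).
  apply: le_trans (ler_norm _) _; rewrite normrM mulrAC -[leRHS]mulrA mulrC ler_pM//.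
  have : 0 <= (`|v 0 i| - `|v 0 j|) ^+ 2 by exact: sqr_ge0.
  by rewrite normrM -(real_normK (num_real (v 0 i))) -(real_normK (num_real (v 0 j)));
    nra.
under eq_bigr do rewrite -mulr_sumr.
rewrite -mulr_sumr E; lra.
Qed.

Lemma qformB A v w :
  qform A (v - w) = qform A v - (v *m A *m w^T) 0 0 - (w *m A *m v^T) 0 0 + qform A w.
Proof.
by rewrite /qform linearB/= mulmxBl mulmxBl !mulmxBr !mxE; ring.
Qed.

Lemma qformZ A c v : qform A (c *: v) = c ^+ 2 * qform A v.
Proof.
by rewrite /qform linearZ/= -scalemxAl -scalemxAl -scalemxAr !mxE; ring.
Qed.

(** Cauchy-Schwarz in the inner product [A] for [v] and [v *m invmx A], whose product is [sqnorm v].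
    The vector [w] of the proof is orthogonal to [v] for [A]. *)
Lemma sqnorm_sqr_le_qform A v : posdef A ->
  sqnorm v ^+ 2 <= qform A v * qform (invmx A) v.
Proof.
move=> pA; have [->|v0] := eqVneq v 0.
  by rewrite /sqnorm /qform !mul0mx mxE mul0r big1 ?expr0n// => i _; rewrite mxE expr0n.
have q0 := pA.2 _ v0.
set q := qform A v in q0 *; set r := qform _ v; set s := sqnorm v.
have uA := posdef_unitmx pA.
have sB : (invmx A)^T = invmx A by rewrite trmx_inv pA.1.
pose w := s *: v - q *: (v *m invmx A).
have w0 : 0 <= qform A w.
  by have [->|/pA.2/ltW//] := eqVneq w 0; rewrite /qform !mul0mx mxE.
have : qform A w = q * (q * r - s ^+ 2).
  rewrite /w qformB !qformZ -qform_invmx// -/q -/r.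
  have bZ (x y : 'rV[R]_n) a b : (a *: x *m A *m (b *: y)^T) 0 0 =
      a * b * (x *m A *m y^T) 0 0.
    by rewrite linearZ/= -scalemxAl -scalemxAl -scalemxAr !mxE; ring.
  rewrite !bZ trmx_mul sB mulmxKV// mulmxA mulmxK// -sqnormE -/s; ring.
move=> E; move: w0; rewrite E pmulr_rge0// subr_ge0.
by [].
Qed.

(** Ellipticity without eigenvalues: the form of the inverse in [sqnorm_sqr_le_qform] is bounded
    through its entries, and one factor [sqnorm v] cancels. *)
Lemma sqnorm_le_qform A v K : posdef A -> (forall i j, `|invmx A i j| <= K) ->
  sqnorm v <= K * n%:R * qform A v.
Proof.
move=> pA AK; have [->|v0] := eqVneq v 0.
  by rewrite /qform !mul0mx mxE mulr0 /sqnorm big1// => i _; rewrite mxE expr0n.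
have s0 := sqnorm_gt0 v0; have q0 := pA.2 _ v0.
have := sqnorm_sqr_le_qform v pA; have := qform_le_entries v AK.
rewrite -(ler_pM2l q0) => h1 h2; have := le_trans h2 h1.
by rewrite expr2 mulrA ler_pM2r// mulrC.
Qed.

Lemma mxtrace_posdef_ge A K : posdef A -> (0 < n)%N -> 0 < K ->
  (forall v, sqnorm v <= K * qform A v) -> K^-1 <= \tr A.
Proof.
move=> pA n0 K0 AK.
have Aii i : K^-1 <= A i i.
  rewrite -div1r; have := AK (delta_mx 0 i); rewrite sqnormE.
  rewrite /qform trmx_delta mul_delta_mx mxE -rowE -colE !mxE !eqxx.
  by rewrite ler_pdivrMr// mulrC.
have Aii0 i : 0 <= A i i by apply: le_trans (Aii i); rewrite invr_ge0 ltW.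
rewrite /mxtrace (bigD1 (Ordinal n0))//=.
by rewrite ler_wpDr// sumr_ge0.
Qed.

(** The squared norm is [c^2] times the trace of the identity. With [c = e^(2f) - 1], this reads the
    conformal factor off the C0 norm. *)
Lemma tensor_norm_scale A (c : R) : posdef A ->
  tensor_norm A (c *: A) = `|c| * Num.sqrt n%:R.
Proof.
move=> pA; rewrite /tensor_norm.
suff -> : \sum_i \sum_j \sum_k \sum_l
    invmx A i k * invmx A j l * (c *: A) i j * (c *: A) k l = c ^+ 2 * n%:R.
  by rewrite sqrtrM ?sqr_ge0// sqrtr_sqr.
transitivity (\sum_i c ^+ 2 * (\sum_j A i j * \sum_l (invmx A *m A) i l * invmx A l j)).
  apply: eq_bigr => i _; rewrite mulr_sumr; apply: eq_bigr => j _.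
  rewrite exchange_big/= !mulr_sumr; apply: eq_bigr => l _.
  rewrite [(invmx A *m A) i l]mxE !mulr_suml !mulr_sumr; apply: eq_bigr => k _.
  have -> : invmx A l j = invmx A j l by rewrite -[in RHS](posdef_invmx pA).1 mxE.
  rewrite !mxE; ring.
rewrite mulVmx ?posdef_unitmx// -mulr_sumr; congr (_ * _).
rewrite -[RHS](@mxtrace1 R n) -[in RHS](mulmxV (posdef_unitmx pA)).
apply: eq_bigr => i _; rewrite mxE; apply: eq_bigr => j _; congr (_ * _).
by rewrite -[in RHS](posdef_invmx pA).1 mxE -[in RHS](mul1mx (invmx A)) mxE.
Qed.

End PositiveDefinite.

(** * Touching by quartic polynomials and the maximum principle *)

Section Touching.
Context {R : realType} {n : nat}.
Implicit Types (x c v : 'rV[R]_n) (U : set 'rV[R]_n).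

Lemma is_derive_coord x v i : is_derive x v (fun y => y 0 i) (v 0 i).
Proof.
apply: DeriveDef; first exact/diff_derivable/differentiable_coord.
have := @derive_mx R 'rV[R]_n 1 n id x v (@derivable_id _ _ _ _).
by rewrite derive_id => /matrixP/(_ 0 i); rewrite !mxE.
Qed.

Lemma is_derive_sqnorm x c v :
  is_derive x v (fun y => sqnorm (y - c)) (2 * \sum_i v 0 i * (x - c) 0 i).
Proof.
rewrite mulr_sumr; apply: is_derive_bigsum => i _.
have d1 : is_derive x v (fun y => (y - c) 0 i) (v 0 i).
  have -> : (fun y => (y - c) 0 i) = (fun y => y 0 i + (- c) 0 i).
    by apply/funext => y; rewrite mxE.
  have := is_derive_add (is_derive_coord x v i) (is_derive_const ((- c) 0 i) x v).
  by rewrite addr0.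
have := is_derive_mul d1 d1; under eq_fun do rewrite -expr2.
by move=> ?; apply: is_derive_eq; ring.
Qed.

Lemma continuous_sqnorm c : continuous (fun x => sqnorm (x - c)).
Proof.
move=> x; apply: continuous_at_sum => i _.
have cy : {for x, continuous (fun y : 'rV[R]_n => (y - c) 0 i)}.
  have -> : (fun y : 'rV[R]_n => (y - c) 0 i) = (fun y => y 0 i + (- c) 0 i).
    by apply/funext => y; rewrite mxE.
  by apply: continuous_at_add; [exact: coord_continuous|exact: cst_continuous].
exact: continuous_at_mul.
Qed.

Lemma sqnormB_sym x c : sqnorm (x - c) = sqnorm (c - x).
Proof. by apply: eq_bigr => i _; rewrite !mxE -sqrrN opprB. Qed.

Lemma sqnorm_triangle x v c :
  sqnorm (x - c) <= 2 * sqnorm (x - v) + 2 * sqnorm (v - c).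
Proof.
rewrite !mulr_sumr -big_split/=; apply: ler_sum => i _; rewrite !mxE.
have : 0 <= (x 0 i - v 0 i - (v 0 i - c 0 i)) ^+ 2 by exact: sqr_ge0.
by nra.
Qed.

Lemma open_sqball c d : open [set x | sqnorm (x - c) < d].
Proof.
have -> : [set x | sqnorm (x - c) < d] =
  (fun x => sqnorm (x - c)) @^-1` [set t | t < d] by [].
by apply: open_comp; [move=> x _; exact: continuous_sqnorm|exact: open_lt].
Qed.

Lemma open_sqball_compl c d : open [set x | d < sqnorm (x - c)].
Proof.
have -> : [set x | d < sqnorm (x - c)] =
  (fun x => sqnorm (x - c)) @^-1` [set t | d < t] by [].
by apply: open_comp; [move=> x _; exact: continuous_sqnorm|exact: open_gt].
Qed.

Lemma closed_sqball c d : closed [set x | sqnorm (x - c) <= d].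
Proof.
have -> : [set x | sqnorm (x - c) <= d] =
  (fun x => sqnorm (x - c)) @^-1` [set t | t <= d] by [].
by apply: closed_comp; [move=> x _; exact: continuous_sqnorm|exact: closed_le].
Qed.

Lemma norm_coord_le_sqnorm v i d : 0 <= d -> sqnorm v <= d ^+ 2 -> `|v 0 i| <= d.
Proof.
move=> d0 vd; rewrite -(ler_pXn2r (n := 2)) ?nnegrE//.
by rewrite real_normK ?num_real//; apply: le_trans vd; exact: sqr_coord_le_sqnorm.
Qed.

Lemma norm_le_sqnorm v d : 0 <= d -> sqnorm v <= d ^+ 2 -> `|v| <= d.
Proof.
move=> d0 vd; rewrite [leLHS]/Num.Def.normr/= mx_normrE.
by apply: bigmax_le => // -[i j] _ /=; rewrite ord1; exact: norm_coord_le_sqnorm.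
Qed.

Lemma compact_sqball c d : compact [set x | sqnorm (x - c) <= d].
Proof.
apply: bounded_closed_compact; last exact: closed_sqball.
exists (`|c| + (1 + `|d|)); split; first exact: num_real.
move=> M cM x /= xd; apply: le_trans (ltW cM).
rewrite -[x](subrK c) addrC; apply: le_trans (ler_normD _ _) _.
rewrite lerD2l; apply: norm_le_sqnorm; first by rewrite addr_ge0.
apply: le_trans xd _; have := ler_norm d; have := normr_ge0 d; nra.
Qed.

(** One family contains both barriers: [k2 = 0] gives the paraboloids of the weak principle,
    [k2 > 0] the barrier of Hopf's argument. *)
Definition quartic c (k0 k1 k2 : R) x :=
  k0 + k1 * sqnorm (x - c) + k2 * sqnorm (x - c) ^+ 2.

Lemma pderiv_quartic c k0 k1 k2 l :
  pderiv l (quartic c k0 k1 k2) =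
  fun x => 2 * (k1 + 2 * k2 * sqnorm (x - c)) * (x - c) 0 l.
Proof.
apply/funext => x; apply: pderivE.
have ds := is_derive_sqnorm x c (delta_mx 0 l).
rewrite (bigD1 l)//= mxE !eqxx mul1r big1 ?addr0 in ds; last first.
  by move=> i /negbTE il; rewrite mxE il andbF mul0r.
have d1 := is_derive_mul (is_derive_const k1 x (delta_mx 0 l)) ds.
have d2 := is_derive_mul (is_derive_const k2 x (delta_mx 0 l)) (is_derive_mul ds ds).
have := is_derive_add (is_derive_add (is_derive_const k0 x (delta_mx 0 l)) d1) d2.
by move=> ?; apply: is_derive_eq; ring.
Qed.

Lemma pderiv2_quartic c k0 k1 k2 i j x :
  pderiv i (pderiv j (quartic c k0 k1 k2)) x =
  2 * (k1 + 2 * k2 * sqnorm (x - c)) * (i == j)%:R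
  + 8 * k2 * ((x - c) 0 i * (x - c) 0 j).
Proof.
rewrite pderiv_quartic; apply: pderivE.
have ds := is_derive_sqnorm x c (delta_mx 0 i).
rewrite (bigD1 i)//= mxE !eqxx mul1r big1 ?addr0 in ds; last first.
  by move=> l /negbTE il; rewrite mxE il andbF mul0r.
have dj : is_derive x (delta_mx 0 i) (fun y => (y - c) 0 j) (i == j)%:R.
  have -> : (fun y => (y - c) 0 j) = (fun y => y 0 j + (- c) 0 j).
    by apply/funext => y; rewrite mxE.
  have := is_derive_add (is_derive_coord x (delta_mx 0 i) j)
                     (is_derive_const ((- c) 0 j) x (delta_mx 0 i)).
  by rewrite addr0 [delta_mx _ _ _ _]mxE eqxx eq_sym.
have d1 := is_derive_mul (is_derive_const (2 * k2) x (delta_mx 0 i)) ds.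
have d2 := is_derive_add (is_derive_const k1 x (delta_mx 0 i)) d1.
have := is_derive_mul (is_derive_mul (is_derive_const 2 x (delta_mx 0 i)) d2) dj.
by move=> ?; apply: is_derive_eq; ring.
Qed.

Lemma C2_quartic U c k0 k1 k2 : open U -> C2 U (quartic c k0 k1 k2).
Proof.
move=> oU.
have cy i : C1 U (fun x => (x - c) 0 i).
  apply: eq_C1 (C1D oU (C1_coord i oU) (C1_cst ((- c) 0 i) oU)) => // y _.
  by rewrite !mxE.
have cs : C1 U (fun x => sqnorm (x - c)).
  by apply: C1_sum => // i _; apply: eq_C1 (C1M oU (cy i) (cy i)) => // y _.
have cC (k : R) : C1 U (fun=> k) by exact: C1_cst.
split=> [|l].
  apply: eq_C1 (C1D oU (C1D oU (cC k0) (C1M oU (cC k1) cs))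
    (C1M oU (cC k2) (C1M oU cs cs))) => // y _; by rewrite -expr2.
rewrite pderiv_quartic; apply: C1M => //; apply: C1M => //.
by apply: C1D => //; apply: C1M.
Qed.

(** At the contact point the gradients agree and the Hessian of the difference is positive
    semidefinite; pairing it with [a] compares the second-order terms, that of the quartic being
    explicit. *)
Lemma touching_quartic U (h : 'rV[R]_n -> R) x c k0 k1 k2 (a : 'M[R]_n) :
  open U -> C2 U h -> U x -> posdef a ->
  (\forall y \near x, h x - quartic c k0 k1 k2 x <= h y - quartic c k0 k1 k2 y) ->
  (forall l, pderiv l h x = 2 * (k1 + 2 * k2 * sqnorm (x - c)) * (x - c) 0 l) /\
  2 * (k1 + 2 * k2 * sqnorm (x - c)) * \tr a + 8 * k2 * qform a (x - c) <=
  \sum_i \sum_j a i j * pderiv i (pderiv j h) x.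
Proof.
move=> oU ch Ux pa hmin; set q := quartic c k0 k1 k2 in hmin.
have cq : C2 U q by exact: C2_quartic.
pose u y := h y - q y.
have du i y : U y -> pderiv i u y = pderiv i h y - pderiv i q y.
  move=> Uy; apply: pderivE.
  exact: is_deriveB (C1_pderiv i ch.1 Uy) (C1_pderiv i cq.1 Uy).
have cu : C2 U u.
  split=> [|i]; first by apply: C1B => //; [exact: ch.1|exact: cq.1].
  have := C1B oU (ch.2 i) (cq.2 i); apply: eq_C1 => // y Uy.
  by rewrite du.
have ddu i j : pderiv i (pderiv j u) x =
    pderiv i (pderiv j h) x - pderiv i (pderiv j q) x.
  rewrite (@eq_pderiv _ _ U _ (fun y => pderiv j h y - pderiv j q y))//; last first.
    by move=> y Uy; exact: du.
  apply: pderivE.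
  exact: is_deriveB (C1_pderiv i (ch.2 j) Ux) (C1_pderiv i (cq.2 j) Ux).
have [u1 u2] := C2_local_min oU cu Ux hmin.
split=> [l|].
  by have /eqP := u1 l; rewrite du// subr_eq0 /q pderiv_quartic => /eqP.
have H : 0 <= \sum_i \sum_j a i j * pderiv i (pderiv j u) x.
  apply: sum_posdef_mul_psd_ge0 => [i j|v [i vi]|v].
  - by rewrite -[in LHS]pa.1 mxE.
  - have /pa.2 : \row_k v k != 0.
      by apply: contra vi => /eqP/rowP/(_ i); rewrite !mxE => ->.
    rewrite qformE; under eq_bigr => k _ do under eq_bigr => l _ do rewrite !mxE.
    by [].
  - have := u2 (\row_k v k).
    by under eq_bigr => k _ do under eq_bigr => l _ do rewrite !mxE.
rewrite -subr_ge0; apply: le_trans H _; rewrite le_eqVlt; apply/orP; left; apply/eqP.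
transitivity (\sum_i \sum_j a i j * pderiv i (pderiv j h) x -
              \sum_i \sum_j a i j * pderiv i (pderiv j q) x).
  rewrite -sumrB; apply: eq_bigr => i _; rewrite -sumrB; apply: eq_bigr => j _.
  by rewrite ddu mulrBr.
congr (_ - _); have q2 i j := pderiv2_quartic c k0 k1 k2 i j x; rewrite -/q in q2.
set t := sqnorm (x - c) in q2 *; clearbody t; rewrite qformE /mxtrace !mulr_sumr -big_split/=.
apply: eq_bigr => i _.
under eq_bigr => j _ do rewrite q2 mulrDr.
rewrite big_split/=; congr (_ + _).
  rewrite (bigD1 i)//= big1 ?addr0 => [|j ji]; first by rewrite eqxx mulr1; ring.
  by rewrite eq_sym (negbTE ji) !mulr0.
by rewrite mulr_sumr; apply: eq_bigr => j _; ring.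
Qed.

End Touching.

(** * Maximum principles for functions supported in a small coordinate ball *)

Section MaximumPrinciple.
Context {R : realType} {n : nat}.
Hypothesis n_gt0 : (0 < n)%N.
Implicit Types (x y c v : 'rV[R]_n).

Definition pderiv_norm (h : 'rV[R]_n -> R) x : R := \sum_i `|pderiv i h x|.

Variables (U : set 'rV[R]_n) (a : 'rV[R]_n -> 'M[R]_n) (x0 : 'rV[R]_n).
Variables (d0 lam Lam C : R).
Let D0 := [set x | sqnorm (x - x0) <= d0].
Hypotheses (oU : open U) (D0U : D0 `<=` U) (d0_gt0 : 0 < d0).
Hypotheses (lam_gt0 : 0 < lam) (C_ge0 : 0 <= C).
Hypothesis a_posdef : forall x, D0 x -> posdef (a x).
Hypothesis a_elliptic : forall x v, D0 x -> lam * sqnorm v <= qform (a x) v.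
Hypothesis a_tr : forall x, D0 x -> \tr (a x) <= Lam.

(** The right-hand side is even in [h], so it can serve for both [f] and [-f]. *)
Definition supersolution (h : 'rV[R]_n -> R) := forall x, D0 x ->
  \sum_i \sum_j a x i j * pderiv i (pderiv j h) x <=
  C * (pderiv_norm h x + pderiv_norm h x ^+ 2 + `|h x|).

Let a_tr_ge x : D0 x -> lam <= \tr (a x).
Proof.
move=> Dx; rewrite -[lam]invrK.
apply: mxtrace_posdef_ge => //; [exact: a_posdef|by rewrite invr_gt0|].
by move=> v; rewrite mulrC ler_pdivlMr// mulrC; exact: a_elliptic.
Qed.

Lemma continuous_at_within (h : 'rV[R]_n -> R) (A : set 'rV[R]_n) :
  (forall x, A x -> {for x, continuous h}) -> {within A, continuous h}.
Proof.
by move=> ch; apply: continuous_in_subspaceT => x /set_mem Ax; exact: ch.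
Qed.

Lemma sum_norm_coord_le v (d : R) : 0 <= d -> sqnorm v <= d ^+ 2 ->
  \sum_i `|v 0 i| <= n%:R * d.
Proof.
move=> dge vd; apply: (@le_trans _ _ (\sum_(i < n) d)).
  by apply: ler_sum => i _; exact: norm_coord_le_sqnorm.
by rewrite sumr_const card_ord mulr_natl.
Qed.

(** The paraboloid has second-order term at least [2 B lam = 2 (C + lam)], which beats the
    zeroth-order [C] with room for gradient terms of size less than [lam]. *)
Let B := C / lam + 1.
Let B_gt0 : 0 < B. Proof. by rewrite ltr_wpDl// divr_ge0// ltW. Qed.
Let Blam : B * lam = C + lam.
Proof. by rewrite /B mulrDl mul1r divfK// gt_eqF. Qed.

Let arith (X : R) : X < lam -> X + C < 2 * (C + lam).
Proof. move: lam_gt0 C_ge0; lra. Qed.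

(* [h] is touched from below by a negative multiple of [1 - B |x - x0|^2]. *)
Lemma weak_maximum_principle (e : R) (h : 'rV[R]_n -> R) :
  0 < e -> e <= 1 -> B * e ^+ 2 <= 2^-1 -> e ^+ 2 <= d0 ->
  e * (C * (2 * B * n%:R + 8 * B ^+ 2 * n%:R ^+ 2)) < lam ->
  C2 U h -> (forall x, D0 x -> `|h x| <= 1) ->
  (forall x, D0 x -> e ^+ 2 <= sqnorm (x - x0) -> h x = 0) ->
  supersolution h -> forall x, D0 x -> 0 <= h x.
Proof.
move=> e0 e1 Be ed0 eC ch h1 hout hsuper.
pose D := [set x | sqnorm (x - x0) <= e ^+ 2].
have DD0 x : D x -> D0 x by move=> Dx; apply: le_trans ed0.
pose w x := 1 - B * sqnorm (x - x0).
have w2 x : D x -> 2^-1 <= w x.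
  by move=> Dx; rewrite /w; have := ler_wpM2l (ltW B_gt0) Dx; lra.
have w0 x : D x -> 0 < w x by move=> /w2; apply: lt_le_trans; rewrite invr_gt0.
have cw x : {for x, continuous w}.
  apply: continuous_at_add; first exact: cst_continuous.
  apply: continuous_at_opp; apply: continuous_at_mul; first exact: cst_continuous.
  exact: continuous_sqnorm.
(* The minimum of the quotient is the multiple of [w] that touches [h] from below. *)
have [|||z /set_mem Dz zmin] := @EVT_min_rV R n (fun x => h x * (w x)^-1) D.
- by exists x0; rewrite /D/= subrr /sqnorm big1 ?sqr_ge0// => i _; rewrite mxE expr0n.
- exact: compact_sqball.
- apply: continuous_at_within => x Dx; apply: continuous_at_mul.
    by apply: C1_continuous ch.1 _; apply: D0U; exact: DD0.
  by apply: continuous_at_inv; [rewrite gt_eqF// w0|exact: cw].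
have [hz|hz] := leP 0 (h z).
  move=> x Dx; have [xe|xe] := leP (e ^+ 2) (sqnorm (x - x0)).
    by rewrite hout.
  have Dex : D x by exact: ltW.
  have := zmin x (mem_set Dex); rewrite ler_pdivrMr ?w0// => /le_trans.
  have hz' : 0 <= h z / w z by rewrite divr_ge0// ltW// w0.
  have : h z / w z <= h x / w x by exact: zmin (mem_set Dex).
  by rewrite ler_pdivlMr ?w0// => H _; apply: le_trans H; rewrite mulr_ge0// ltW// w0.
exfalso.
pose m := - (h z / w z).
have m0 : 0 < m by rewrite oppr_gt0 pmulr_llt0// invr_gt0 w0.
have hmw : h z = - m * w z by rewrite /m opprK divfK// gt_eqF// w0.
have Dz0 := DD0 _ Dz.
(* The bound [|h| <= 1] enters here: with [m <= 2] the squared gradient, of order [m^2], is bounded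
   linearly in [m], so that [m] cancels in the end. *)
have m2 : m <= 2.
  have := h1 z Dz0; rewrite hmw normrM normrN !gtr0_norm ?w0// => mw.
  have := ler_wpM2l (ltW m0) (w2 z Dz); lra.
(* Since [h] vanishes on the sphere of radius [e], negative contact occurs strictly inside, where
   the minimum over [D] is a local minimum. *)
have ze : sqnorm (z - x0) < e ^+ 2.
  by rewrite ltNge; apply/negP => /(hout z Dz0) hz0; rewrite hz0 ltxx in hz.
have [|dh ddh] := @touching_quartic R n U h z x0 (- m) (m * B) 0 (a z)
  oU ch (D0U Dz0) (a_posdef Dz0).
  near=> y; have Dy : D y.
    by apply: ltW; near: y; apply: open_nbhs_nbhs; split; [exact: open_sqball|].
  rewrite /quartic; have := zmin y (mem_set Dy).
  rewrite ler_pdivlMr ?w0// -[h z / w z]opprK -/m /w => H.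
  rewrite hmw /w; lra.
have := hsuper z Dz0; move: ddh; rewrite mulr0 mul0r addr0 mulr0 mul0r addr0.
move=> /le_trans/[apply].
set s := \sum_i `|(z - x0) 0 i|.
have -> : pderiv_norm h z = 2 * (m * B) * s.
  rewrite /pderiv_norm mulr_sumr; apply: eq_bigr => i _.
  rewrite dh mulr0 mul0r addr0 normrM gtr0_norm//.
  by rewrite mulr_gt0// mulr_gt0.
have sn : s <= n%:R * e by exact: sum_norm_coord_le (ltW e0) Dz.
have s0 : 0 <= s by apply: sumr_ge0.
have hm : `|h z| <= m.
  rewrite hmw normrM normrN (gtr0_norm m0) (gtr0_norm (w0 z Dz)).
  apply: ler_piMr; first exact: ltW.
  rewrite /w; have := mulr_ge0 (ltW B_gt0) (sqnorm_ge0 (z - x0)); lra.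
apply/negP; rewrite -ltNge.
have n0 : 0 <= n%:R :> R by [].
set N : R := n%:R in n0 sn eC *.
have trz := a_tr_ge Dz0.
(* Up to the factor [m], the barrier contributes [2 B lam], whereas the gradient terms are of order
   [e] because the paraboloid is flat near its centre. *)
apply: (@lt_le_trans _ _ (2 * (m * B) * lam)); last first.
  by rewrite ler_wpM2l// mulr_ge0// ltW// mulr_gt0.
have H1 : C * (2 * B * s + 8 * B ^+ 2 * s ^+ 2) < lam.
  apply: le_lt_trans eC; rewrite [e * _]mulrCA ler_wpM2l//.
  have s2 : s ^+ 2 <= e * N ^+ 2.
    apply: (@le_trans _ _ ((N * e) ^+ 2)); first by rewrite ler_pXn2r ?nnegrE// mulr_ge0// ltW.
    rewrite exprMn mulrC ler_wpM2r ?sqr_ge0// expr2 ler_piMr// ltW//.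
  have := ler_wpM2l (ltW B_gt0) sn; have := ler_wpM2l (sqr_ge0 B) s2; lra.
have H2 : 2 * (m * B) * s + (2 * (m * B) * s) ^+ 2 + `|h z| <=
    m * (2 * B * s + 8 * B ^+ 2 * s ^+ 2 + 1).
  have : m * (B ^+ 2 * s ^+ 2) * m <= m * (B ^+ 2 * s ^+ 2) * 2.
    by rewrite ler_wpM2l// mulr_ge0 ?(ltW m0)// mulr_ge0// sqr_ge0.
  by rewrite !exprMn => ?; lra.
apply: le_lt_trans (ler_wpM2l C_ge0 H2) _.
have -> : 2 * (m * B) * lam = m * (2 * (C + lam)) by rewrite -Blam; ring.
rewrite [C * _]mulrCA ltr_pM2l//.
by rewrite mulrDr mulr1; exact: arith.
Unshelve. all: by end_near. Qed.

(* If [h c > 0], let [r2] be the squared distance from [c] to the zero set of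
   [h]; near the sphere of radius [sqrt r2] the function [h] is touched from
   below by a small multiple of [p + kap p^2], where [p = r2 - |x - c|^2]. *)
Lemma strong_maximum_principle (e : R) (h : 'rV[R]_n -> R) :
  0 < e -> 20 * e ^+ 2 <= d0 -> C2 U h ->
  (forall x, D0 x -> e ^+ 2 <= sqnorm (x - x0) -> h x = 0) ->
  (forall x, D0 x -> 0 <= h x) ->
  supersolution h -> forall x, D0 x -> h x = 0.
Proof.
move=> e0 ed0 ch hout hge0 hsuper c Dc; apply/eqP/negPn/negP => hcn0.
have hc : 0 < h c by rewrite lt0r hcn0 hge0.
have hcont x : D0 x -> {for x, continuous h}.
  by move=> Dx; apply: C1_continuous ch.1 _; exact: D0U.
have e20 : 0 < e ^+ 2 by rewrite exprn_gt0.
have ce : sqnorm (c - x0) < e ^+ 2.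
  by rewrite ltNge; apply/negP => /(hout c Dc) E; rewrite E eqxx in hcn0.
pose Z := [set x | D0 x /\ h x = 0].
have cZ : compact Z.
  apply: (subclosed_compact _ (@compact_sqball R n x0 d0)); last by move=> x [].
  move=> x Zx; have Dx : D0 x.
    by apply: closed_sqball => W /Zx[y [[Dy _] Wy]]; exists y.
  split=> //; apply/eqP/negPn/negP => hx.
  have : \forall y \near x, h y != 0.
    have := hcont x Dx; rewrite /prop_for /continuous_at => /cvgr_neq0.
    by move=> /(_ hx).
  by move=> /Zx[y [[_ hy]]] /=; rewrite hy eqxx.
(* A point at distance exactly [e] from [x0] is a zero of [h]; it makes [Z] nonempty and bounds the
   distance from [c] to [Z] by a multiple of [e]. *)
pose z0 := x0 + e *: delta_mx 0 (Ordinal n_gt0).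
have z0e : sqnorm (z0 - x0) = e ^+ 2.
  rewrite /z0 addrAC subrr add0r /sqnorm (bigD1 (Ordinal n_gt0))//= !mxE !eqxx mulr1.
  by rewrite big1 ?addr0// => i /negbTE ni; rewrite !mxE ni andbF mulr0 expr0n.
have Zz0 : Z z0.
  have Dz0 : D0 z0 by rewrite /D0/= z0e; move: ed0 e20; lra.
  by split=> //; apply: hout => //; rewrite z0e.
have [|||y /set_mem[Dy hy] ymin] := @EVT_min_rV R n (fun x => sqnorm (x - c)) Z.
- by exists z0.
- exact: cZ.
- by apply: continuous_at_within => x _; exact: continuous_sqnorm.
set r2 := sqnorm (y - c) in ymin.
have r20 : 0 < r2.
  apply: sqnorm_gt0; apply: contra hcn0; rewrite subr_eq0 => /eqP <-.
  by rewrite hy.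
have r24 : r2 <= 4 * e ^+ 2.
  apply: le_trans (ymin z0 (mem_set Zz0)) _.
  apply: le_trans (sqnorm_triangle z0 x0 c) _.
  by rewrite z0e (sqnormB_sym x0); move: ce; lra.
(* The triangle inequality for squares costs factors 2: here [4 r2 + 2 e^2 <= 18 e^2], below the
   [20 e^2] that [ed0] allows. *)
have near_D0 x : sqnorm (x - c) <= 2 * r2 -> D0 x.
  move=> xc; apply: le_trans (sqnorm_triangle x c x0) _.
  by move: xc r24 ce ed0 e20; lra.
have hpos x : sqnorm (x - c) < r2 -> 0 < h x.
  move=> xr; have Dx : D0 x by apply: near_D0; move: xr r20; lra.
  rewrite lt0r hge0// andbT; apply/negP => /eqP hx.
  by have := ymin x (mem_set (conj Dx hx)); rewrite leNgt xr.
pose T : R := n%:R * (1 + r2).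
(* In the annulus [8 kap qform (a z) (z - c)] is at least [4 kap lam r2]. This [kap] makes it exceed
   the trace and lower-order terms by 1; [T] bounds the sum of the [|z_i - c_i|]. *)
pose kap := (4 * `|Lam| + C * (4 * T + 16 * T ^+ 2 + r2) + 1) / (4 * lam * r2).
have T0 : 0 <= T by rewrite mulr_ge0// addr_ge0// ltW.
have CT0 : 0 <= C * (4 * T + 16 * T ^+ 2 + r2).
  by rewrite mulr_ge0//; move: T0 r20 (sqr_ge0 T); lra.
have kap0 : 0 < kap.
  rewrite divr_gt0 ?mulr_gt0//.
  by move: CT0 (normr_ge0 Lam); lra.
have kapE : kap * (4 * lam * r2) = 4 * `|Lam| + C * (4 * T + 16 * T ^+ 2 + r2) + 1.
  by rewrite /kap divfK// gt_eqF// !mulr_gt0.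
(* The first bound gives [1 + kap p >= 1/2] for [|p| <= tau], so the barrier has the sign of [p];
   the second keeps the annulus inside [D0] and away from [c]. *)
pose tau := Num.min (2 * kap)^-1 (r2 / 2).
have tau0 : 0 < tau by rewrite lt_min invr_gt0 mulr_gt0//= divr_gt0.
have tau1 : kap * tau <= 2^-1.
  have : tau <= (2 * kap)^-1 by rewrite ge_min lexx.
  by rewrite -(ler_pM2l kap0) => /le_trans; apply; rewrite invfM mulrCA mulfV ?mulr1 ?gt_eqF.
have tau2 : tau <= r2 / 2 by rewrite ge_min lexx orbT.
have [|||z1 /set_mem z1c z1min] := @EVT_min_rV R n h [set x | sqnorm (x - c) <= r2 - tau].
- exists c; rewrite /= subrr /sqnorm big1 => [|i _]; last by rewrite mxE expr0n.
  by move: tau2 r20; lra.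
- exact: compact_sqball.
- apply: continuous_at_within => x /= xr; apply/hcont/near_D0; move: xr tau0 r20; lra.
have mu0 : 0 < h z1 by apply: hpos; apply: le_lt_trans z1c _; move: tau0; lra.
(* On the inner sphere the barrier is at most [(3/2) eps tau], below the lower bound [h z1] of [h];
   [eps <= 1] makes the squared gradient linear in [eps]. *)
pose eps := Num.min 1 (h z1 / (2 * tau)).
have eps0 : 0 < eps by rewrite lt_min ltr01 divr_gt0// mulr_gt0.
have eps1 : eps <= 1 by rewrite ge_min lexx.
have epsmu : eps * (2 * tau) <= h z1.
  have : eps <= h z1 / (2 * tau) by rewrite ge_min lexx orbT.
  by rewrite ler_pdivlMr// mulr_gt0.
pose k0 := eps * (r2 + kap * r2 ^+ 2).
pose k1 := - (eps * (1 + 2 * kap * r2)).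
pose k2 := eps * kap.
have qE x : quartic c k0 k1 k2 x =
    eps * ((r2 - sqnorm (x - c)) + kap * (r2 - sqnorm (x - c)) ^+ 2).
  by rewrite /quartic /k0 /k1 /k2; ring.
set q := quartic c k0 k1 k2 in qE.
(* The annulus lies on both sides of the sphere through [y], so contact at [y] itself is also
   interior. *)
pose N := [set x | r2 - tau <= sqnorm (x - c) <= r2 + tau].
have ND0 x : N x -> D0 x.
  by move=> /andP[_ xr]; apply: near_D0; move: xr tau2 r20; lra.
have [|||z /set_mem Nz zmin] := @EVT_min_rV R n (fun x => h x - q x) N.
- by exists y; apply/andP; rewrite -/r2; move: tau0; lra.
- apply: (subclosed_compact _ (@compact_sqball R n c (r2 + tau))); last first.
    by move=> x /andP[].
  have -> : N = (fun x => sqnorm (x - c)) @^-1` [set t | r2 - tau <= t] `&`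
               [set x | sqnorm (x - c) <= r2 + tau].
    by apply/seteqP; split=> x => [/andP[]|[? ?]]//; apply/andP.
  apply: closedI; last exact: closed_sqball.
  by apply: closed_comp; [move=> x _; exact: continuous_sqnorm|exact: closed_ge].
- apply: continuous_at_within => x Nx; apply: continuous_at_add; first exact/hcont/ND0.
  apply: continuous_at_opp; have [cq _] := @C2_quartic R n setT c k0 k1 k2 openT.
  exact: (C1_continuous cq (I : setT x)).
set s := sqnorm (z - c).
have Dz := ND0 z Nz.
(* Both [h] and [q] vanish at [y], so the minimum of [h - q] is at most 0. *)
have uz : h z <= q z.
  have Ny : N y by apply/andP; rewrite -/r2; move: tau0; lra.
  have := zmin y (mem_set Ny).
  by rewrite hy [q y]qE -/r2 subrr expr0n/= mulr0 addr0 mulr0 subr0 subr_le0.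
have := qE z; rewrite -/s; set p := r2 - s => qz.
have kt : kap * tau ^+ 2 <= tau / 2.
  by rewrite expr2 mulrA; have := ler_wpM2r (ltW tau0) tau1; rewrite [2^-1 * _]mulrC.
have slo : r2 - tau < s.
  have /andP[] := Nz; rewrite -/s le_eqVlt => /orP[/eqP sE|//] _.
  have := z1min z (mem_set _); rewrite /= -/s -sE lexx => /(_ isT) z1z.
  have pE : p = tau by rewrite /p -sE; ring.
  have := le_trans z1z uz; rewrite qz pE => H.
  have := ler_wpM2l (ltW eps0) kt; move: H epsmu (mulr_gt0 eps0 tau0); lra.
(* Outside the sphere the barrier is negative and [h >= 0], so contact there is impossible; [slo]
   has excluded the inner sphere. *)
have p0 : 0 <= p.
  rewrite leNgt; apply/negP => pneg.
  have /andP[_ shi] := Nz; rewrite -/s in shi.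
  have ptau : - tau <= p by rewrite /p; move: shi; lra.
  have : q z < 0.
    rewrite qz pmulr_rlt0// expr2 mulrA -[X in X + _]mul1r -mulrDl nmulr_llt0//.
    have := ler_wpM2l (ltW kap0) ptau; move: tau1; lra.
  by rewrite ltNge (le_trans (hge0 z Dz) uz).
have pt : p < tau by rewrite /p; move: slo; lra.
have [|dh ddh] := @touching_quartic R n U h z c k0 k1 k2 (a z) oU ch (D0U Dz) (a_posdef Dz).
  rewrite -/q; near=> x; apply: zmin; apply/mem_set/andP; split; apply: ltW.
    near: x; apply: open_nbhs_nbhs; split; first exact: open_sqball_compl.
    by [].
  near: x; apply: open_nbhs_nbhs; split; first exact: open_sqball.
  by rewrite /= -/s; move: p0 tau0; rewrite /p; lra.
have kE : 2 * (k1 + 2 * k2 * s) = - (2 * eps * (1 + 2 * kap * p)).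
  by rewrite /k1 /k2 /p; ring.
have kp : kap * p <= 2^-1 by apply: le_trans tau1; rewrite ler_pM2l// ltW.
have kp0 : 0 <= kap * p by rewrite mulr_ge0// ltW.
have := le_trans ddh (hsuper z Dz); rewrite -/s kE.
apply/negP; rewrite -ltNge.
set sg := \sum_i `|(z - c) 0 i|.
have sgT : sg <= T.
  apply: sum_norm_coord_le; first by rewrite addr_ge0// ltW.
  by rewrite -/s; move: p0 r20; rewrite /p; nra.
have sg0 : 0 <= sg by apply: sumr_ge0.
have pnE : pderiv_norm h z = 2 * eps * (1 + 2 * (kap * p)) * sg.
  rewrite /pderiv_norm mulr_sumr; apply: eq_bigr => i _.
  rewrite dh -/s kE mulNr normrN normrM ger0_norm; first by rewrite mulrA.
  rewrite mulr_ge0 ?mulr_ge0 ?(ltW eps0)//; move: kp0; lra.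
have pnT : pderiv_norm h z <= eps * (4 * T).
  have -> : pderiv_norm h z = eps * (2 * ((1 + 2 * (kap * p)) * sg)) by rewrite pnE; ring.
  rewrite ler_pM2l//.
  have : (1 + 2 * (kap * p)) * sg <= 2 * T by apply: ler_pM => //; move: kp kp0; lra.
  lra.
have pn0 : 0 <= pderiv_norm h z by apply: sumr_ge0.
have pn2 : pderiv_norm h z ^+ 2 <= eps * (16 * T ^+ 2).
  apply: (@le_trans _ _ ((eps * (4 * T)) ^+ 2)).
    by rewrite ler_pXn2r ?nnegrE// mulr_ge0 ?(ltW eps0)// mulr_ge0.
  have -> : (eps * (4 * T)) ^+ 2 = eps * (eps * (16 * T ^+ 2)) by ring.
  by rewrite ler_pM2l//; apply: ler_piMl => //; apply: mulr_ge0 => //; exact: sqr_ge0.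
have hz : `|h z| <= eps * r2.
  rewrite ger0_norm ?hge0//; apply: le_trans uz _; rewrite qz ler_pM2l//.
  have : kap * p ^+ 2 <= p / 2 by rewrite expr2 mulrA [p / 2]mulrC ler_wpM2r.
  move: pt tau2; lra.
have rhs : C * (pderiv_norm h z + pderiv_norm h z ^+ 2 + `|h z|) <=
    eps * (C * (4 * T + 16 * T ^+ 2 + r2)).
  rewrite mulrCA ler_wpM2l//; move: pnT pn2 hz; lra.
apply: le_lt_trans rhs _.
have qa : lam * (r2 / 2) <= qform (a z) (z - c).
  apply: le_trans (a_elliptic (z - c) Dz); rewrite -/s ler_pM2l//.
  by move: slo tau2; lra.
have trL : \tr (a z) <= `|Lam| by apply: le_trans (a_tr Dz) (ler_norm _).
have tr0 : 0 <= \tr (a z) by apply: le_trans (a_tr_ge Dz); exact: ltW.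
have trb : (1 + 2 * (kap * p)) * \tr (a z) <= 2 * `|Lam|.
  by apply: ler_pM => //; move: kp kp0; lra.
have main : C * (4 * T + 16 * T ^+ 2 + r2) <
    - (2 * (1 + 2 * (kap * p)) * \tr (a z)) + 8 * (kap * qform (a z) (z - c)).
  have := ler_wpM2l (ltW kap0) qa; move: trb kapE; lra.
rewrite -(ltr_pM2l eps0) in main; apply: lt_le_trans main _.
by rewrite /k2 le_eqVlt; apply/orP; left; apply/eqP; ring.
Unshelve. all: by end_near. Qed.

(** The weak principle supplies the sign that the strong one assumes. Since [e] is chosen before
    [h], one radius will serve all conformal factors. *)
Lemma small_support_maximum_principle :
  exists e : R, [/\ 0 < e, 20 * e ^+ 2 <= d0 & forall h : 'rV[R]_n -> R,
    C2 U h -> (forall x, D0 x -> `|h x| <= 1) ->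
    (forall x, D0 x -> e ^+ 2 <= sqnorm (x - x0) -> h x = 0) ->
    supersolution h -> forall x, D0 x -> h x = 0].
Proof.
pose Q := C * (2 * B * n%:R + 8 * B ^+ 2 * n%:R ^+ 2).
have Q0 : 0 <= Q.
  by rewrite mulr_ge0// addr_ge0// mulr_ge0// ?mulr_ge0 ?sqr_ge0 ?exprn_ge0// ltW.
(* The four bounds yield, in order, [e^2 <= e], [B e^2 <= 1/2], [20 e^2 <= d0] and [e Q < lam]. *)
pose e := Num.min (Num.min 1 (2 * B)^-1) (Num.min (d0 / 20) (lam / (Q + 1))).
have e0 : 0 < e.
  rewrite !lt_min ltr01 invr_gt0 mulr_gt0//= divr_gt0//= divr_gt0//.
  by rewrite ltr_wpDl.
have e1 : e <= 1 by rewrite !ge_min lexx.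
have e2 : e <= (2 * B)^-1 by rewrite !ge_min lexx orbT.
have e3 : e <= d0 / 20 by rewrite !ge_min lexx !orbT.
have e4 : e <= lam / (Q + 1) by rewrite !ge_min lexx !orbT.
have ee : e ^+ 2 <= e by rewrite expr2 ler_piMr// ltW.
have e5 : 20 * e ^+ 2 <= d0 by move: e3 ee; lra.
exists e; split=> // h ch h1 hout hs.
apply: (strong_maximum_principle e0) => //.
apply: (weak_maximum_principle e0) => //.
- have := ler_wpM2l (ltW B_gt0) (le_trans ee e2).
  have -> // : B * (2 * B)^-1 = 2^-1.
  by move: B_gt0; move: (B) => b b0; field; rewrite gt_eqF.
- by move: e5 (sqr_ge0 e); lra.
- move: e4; rewrite ler_pdivlMr ?ltr_wpDl// -/Q mulrDr mulr1; move: e0; lra.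
Qed.

End MaximumPrinciple.

(** * Conformal change of the scalar curvature *)

Section ConformalCurvature.
Context {R : realType} {n : nat}.
Implicit Types (x : 'rV[R]_n) (U K : set 'rV[R]_n).

Lemma sum_delta_l (f : 'I_n -> R) j : \sum_k (k == j)%:R * f k = f j.
Proof.
rewrite (bigD1 j)//= eqxx mul1r big1 ?addr0// => k /negbTE ->.
by rewrite mul0r.
Qed.

Lemma sum_delta_r (f : 'I_n -> R) j : \sum_k (j == k)%:R * f k = f j.
Proof. by under eq_bigr do rewrite eq_sym; exact: sum_delta_l. Qed.

Lemma ler_norm_sum_const (f : 'I_n -> R) (b : R) : (forall i, `|f i| <= b) ->
  `|\sum_i f i| <= n%:R * b.
Proof.
move=> fb; apply: le_trans (ler_norm_sum _ _ _) _.
apply: (@le_trans _ _ (\sum_(i < n) b)); first by apply: ler_sum.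
by rewrite sumr_const card_ord mulr_natl.
Qed.

(** For [g] the inverse metric, [H] the metric and [P] the Hessian of the factor, this is the trace
    of the second-order part of the Ricci change; its terms count [1 + 1 - n - n]. *)
Lemma sum_sym_trace (g H P : 'I_n -> 'I_n -> R) :
  (forall i j, g i j = g j i) -> (forall i, \sum_j g i j * H i j = 1) ->
  \sum_i \sum_j g i j * (P j i + P i j - H i j * (\sum_k \sum_l g k l * P k l)
                         - n%:R * P j i) =
  (2 - 2 * n%:R) * \sum_k \sum_l g k l * P k l.
Proof.
move=> gs gH; set Q := \sum_k \sum_l g k l * P k l.
have Q' : \sum_i \sum_j g i j * P j i = Q.
  rewrite exchange_big/=; apply: eq_bigr => i _; apply: eq_bigr => j _.
  by rewrite gs.
have tr : \sum_i \sum_j g i j * H i j = n%:R.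
  by under eq_bigr => i _ do rewrite gH; rewrite sumr_const card_ord.
transitivity (\sum_i \sum_j g i j * P j i + \sum_i \sum_j g i j * P i j
  - (\sum_i \sum_j g i j * H i j) * Q - n%:R * \sum_i \sum_j g i j * P j i).
  rewrite mulr_suml mulr_sumr -big_split/= -!sumrB.
  apply: eq_bigr => i _; rewrite mulr_suml mulr_sumr -big_split/= -!sumrB.
  by apply: eq_bigr => j _; ring.
by rewrite Q' tr -/Q; ring.
Qed.

Let ricci_linear_part (p q r s u v : R) :
  p + (q + r) - (s + (u + v)) - (p - s) - (q - u) = r - v.
Proof. ring. Qed.

(** Only products with at least one factor from the difference of the connections survive, so every
    surviving term contains [dF]. *)
Let ricci_product_part (p q r s u v w z : R) :
  (p + q) * (r + s) - (u + v) * (w + z) - (p * r - u * w) =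
  p * s + q * r + q * s - (u * z + v * w + v * z).
Proof. ring. Qed.

Lemma bounded_family (I : finType) (f : I -> 'rV[R]_n -> R) K : compact K ->
  (forall i x, K x -> {for x, continuous (f i)}) ->
  exists2 b : R, 0 <= b & forall i x, K x -> `|f i x| <= b.
Proof.
move=> cK cf.
have /choice[b bP] : forall i, exists b : R, forall x, K x -> `|f i x| <= b.
  move=> i; have [K0|K0] := pselect (K !=set0); last first.
    by exists 0 => x Kx; case: K0; exists x.
  have [|z _ zmax] := @EVT_max_rV R n (fun x => `|f i x|) K K0 cK.
    apply: continuous_at_within => x Kx.
    exact: (cvg_norm (cf i x Kx)).
  by exists `|f i z| => x Kx; apply: zmax; exact: mem_set.
exists (\sum_i `|b i|); first by apply: sumr_ge0.
move=> i x Kx; apply: le_trans (bP i x Kx) _; apply: le_trans (ler_norm _) _.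
by rewrite (bigD1 i)//= lerDl sumr_ge0.
Qed.

Variables (U : set 'rV[R]_n) (G : 'rV[R]_n -> 'M[R]_n).
Hypotheses (oU : open U) (G_C2 : forall i j, C2 U (fun x => G x i j)).
Hypothesis G_posdef : forall x, U x -> posdef (G x).

Local Notation Ginv x := (invmx (G x)).

Let G_sym x i j : U x -> G x i j = G x j i.
Proof. by move=> Ux; rewrite -[in LHS](G_posdef Ux).1 mxE. Qed.

Let Ginv_sym x i j : U x -> Ginv x i j = Ginv x j i.
Proof. by move=> Ux; rewrite -[in LHS](posdef_invmx (G_posdef Ux)).1 mxE. Qed.

Let GinvG x k j : U x -> \sum_l Ginv x k l * G x j l = (k == j)%:R.
Proof.
move=> Ux; have := mulVmx (posdef_unitmx (G_posdef Ux)).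
move=> /matrixP/(_ k j); rewrite !mxE => <-.
by apply: eq_bigr => l _; rewrite (G_sym j).
Qed.

Lemma C1_Ginv k l : C1 U (fun x => Ginv x k l).
Proof.
apply: C1_invmx => // [x Ux|i j]; first exact/posdef_unitmx/G_posdef.
exact: (G_C2 i j).1.
Qed.

Lemma C1_christoffel k i j : C1 U (christoffel G k i j).
Proof.
apply: C1M => //; first exact: C1_cst.
apply: C1_sum => // l _; apply: C1M => //; first exact: C1_Ginv.
apply: C1B => //; last exact: (G_C2 i j).2.
by apply: C1D => //; [exact: (G_C2 j l).2|exact: (G_C2 i l).2].
Qed.

(** Contracted with [dF], this is the difference of the Levi-Civita connections of [e^(2F) G] and
    [G]. Kept apart from [dF], it depends on [G] alone and has bounds uniform in [F]. *)
Definition christoffel_coef (k i j l : 'I_n) x : R :=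
  (k == j)%:R * (i == l)%:R + (k == i)%:R * (j == l)%:R - G x i j * Ginv x k l.

Lemma C1_christoffel_coef k i j l : C1 U (christoffel_coef k i j l).
Proof.
apply: C1B => //; first exact: C1_cst.
by apply: C1M => //; [exact: (G_C2 i j).1|exact: C1_Ginv].
Qed.

Lemma continuous_scalar_curvature_coord x : U x ->
  {for x, continuous (scalar_curvature_coord G)}.
Proof.
move=> Ux.
have cG k i j := C1_christoffel k i j.
apply: continuous_at_sum => i _; apply: continuous_at_sum => j _.
apply: continuous_at_mul; first exact: C1_continuous (C1_Ginv i j) Ux.
apply: continuous_at_add.
  apply: continuous_at_sum => k _; apply: continuous_at_add; last apply: continuous_at_opp.
    exact: C1_pderiv_continuous Ux.
  exact: C1_pderiv_continuous Ux.
apply: continuous_at_sum => k _; apply: continuous_at_sum => l _.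
apply: continuous_at_add; last apply: continuous_at_opp.
  by apply: continuous_at_mul; apply: C1_continuous Ux.
by apply: continuous_at_mul; apply: C1_continuous Ux.
Qed.

Section Factor.
Variable F : 'rV[R]_n -> R.
Hypothesis F_C2 : C2 U F.

Definition conformal_metric x := expR (2 * F x) *: G x.
Local Notation Gt := conformal_metric.

Lemma invmx_conformal_metric x k l : U x ->
  invmx (Gt x) k l = (expR (2 * F x))^-1 * Ginv x k l.
Proof.
move=> Ux; rewrite /Gt invmxZ ?mxE// unitmxZ; last by rewrite unitfE gt_eqF// expR_gt0.
exact/posdef_unitmx/G_posdef.
Qed.

Lemma pderiv_conformal_metric x i j l : U x ->
  pderiv i (fun y => Gt y j l) x =
  expR (2 * F x) * (2 * pderiv i F x * G x j l + pderiv i (fun y => G y j l) x).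
Proof.
move=> Ux; apply: pderivE.
have d2F := is_derive_mul (is_derive_const 2 x (delta_mx 0 i)) (C1_pderiv i F_C2.1 Ux).
have := is_derive_mul (is_derive_expR_comp d2F) (C1_pderiv i (G_C2 j l).1 Ux).
have -> : (fun y => Gt y j l) = (fun y => expR (2 * F y) * G y j l).
  by apply/funext => y; rewrite mxE.
by move=> ?; apply: is_derive_eq; ring.
Qed.

Definition christoffel_diff k i j x : R :=
  \sum_l christoffel_coef k i j l x * pderiv l F x.
Local Notation T := christoffel_diff.
Local Notation t := christoffel_coef.

(** The exponential in the metric cancels that in the inverse, and differentiating it brings down
    [2 dF]; the contractions of [G] with its inverse become Kronecker deltas. *)
Lemma christoffel_conformal x k i j : U x ->
  christoffel Gt k i j x =
  christoffel G k i j x + T k i j x.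
Proof.
move=> Ux; rewrite /christoffel /christoffel_diff.
have en0 : expR (2 * F x) != 0 by rewrite gt_eqF// expR_gt0.
under eq_bigr => l _ do rewrite invmx_conformal_metric// !pderiv_conformal_metric//.
have -> : \sum_l (expR (2 * F x))^-1 * Ginv x k l *
    (expR (2 * F x) * (2 * pderiv i F x * G x j l + pderiv i (fun y => G y j l) x) +
     expR (2 * F x) * (2 * pderiv j F x * G x i l + pderiv j (fun y => G y i l) x) -
     expR (2 * F x) * (2 * pderiv l F x * G x i j + pderiv l (fun y => G y i j) x)) =
   \sum_l Ginv x k l * (pderiv i (fun y => G y j l) x + pderiv j (fun y => G y i l) x -
      pderiv l (fun y => G y i j) x) +
   2 * (pderiv i F x * \sum_l Ginv x k l * G x j l +
        pderiv j F x * \sum_l Ginv x k l * G x i l -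
        \sum_l G x i j * Ginv x k l * pderiv l F x).
  rewrite !mulr_sumr -big_split/= -sumrB mulr_sumr -big_split/=.
  move: en0; set e := expR _ => e0; apply: eq_bigr => l _.
  set a1 := pderiv i _ x; set a2 := pderiv j _ x; set a3 := pderiv l _ x.
  set a4 := pderiv i _ x; set a5 := pderiv j _ x; set a6 := pderiv l _ x.
  by field.
rewrite mulrDr; congr (_ + _); rewrite mulrA mulVf ?mul1r// !GinvG//.
under [RHS]eq_bigr do rewrite mulrBl mulrDl -!mulrA.
rewrite sumrB big_split/= -!mulr_sumr !sum_delta_r.
congr (_ + _ - _); try exact: mulrC.
by rewrite ?mulr_sumr; apply: eq_bigr => l _; rewrite mulrA.
Qed.

Lemma C1_christoffel_diff k i j : C1 U (T k i j).
Proof.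
apply: C1_sum => // l _; apply: C1M => //; first exact: C1_christoffel_coef.
exact: F_C2.2.
Qed.

Lemma pderiv_christoffel_diff m k i j x : U x ->
  pderiv m (T k i j) x =
  \sum_l (t k i j l x * pderiv m (pderiv l F) x + pderiv l F x * pderiv m (t k i j l) x).
Proof.
move=> Ux; apply: pderivE; apply: is_derive_bigsum => l _.
apply: is_derive_mul; first exact: C1_pderiv (C1_christoffel_coef k i j l) Ux.
exact: C1_pderiv (F_C2.2 l) Ux.
Qed.

Lemma pderiv_christoffel_conformal m k i j x : U x ->
  pderiv m (christoffel Gt k i j) x =
  pderiv m (christoffel G k i j) x + pderiv m (T k i j) x.
Proof.
move=> Ux.
rewrite (@eq_pderiv _ _ U _ (fun y => christoffel G k i j y + T k i j y))//; last first.
  by move=> y Uy; exact: christoffel_conformal.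
apply: pderivE; apply: is_derive_add.
  exact: C1_pderiv (C1_christoffel k i j) Ux.
exact: C1_pderiv (C1_christoffel_diff k i j) Ux.
Qed.

(** This part of the Ricci change carries all second derivatives of [F] and is computed exactly; the
    rest is only estimated. *)
Definition ricci_principal i j x : R := \sum_k \sum_l
  (t k i j l x * pderiv k (pderiv l F) x - t k i k l x * pderiv j (pderiv l F) x).

Lemma ricci_principalE i j x : U x ->
  ricci_principal i j x =
  pderiv j (pderiv i F) x + pderiv i (pderiv j F) x
  - G x i j * (\sum_k \sum_l Ginv x k l * pderiv k (pderiv l F) x)
  - n%:R * pderiv j (pderiv i F) x.
Proof.
move=> Ux; rewrite /ricci_principal.
under eq_bigr => k _ do rewrite sumrB.
rewrite sumrB; congr (_ - _).
  under eq_bigr => k _ do (under eq_bigr => l _ do rewrite /t mulrBl mulrDl -!mulrA).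
  under eq_bigr => k _ do rewrite sumrB big_split/= -!mulr_sumr !sum_delta_r.
  rewrite -(sum_delta_l (fun k => pderiv k (pderiv i F) x)).
  rewrite -(sum_delta_l (fun k => pderiv k (pderiv j F) x)) mulr_sumr.
  by rewrite -big_split/= -sumrB.
rewrite exchange_big/=.
(* The contracted Christoffel symbol is the logarithmic derivative of the volume density, which
   scales by [e^(n F)]. *)
have tr l : \sum_k t k i k l x = n%:R * (i == l)%:R.
  rewrite /t sumrB big_split/=.
  under eq_bigr => k _ do rewrite eqxx mul1r.
  rewrite sumr_const card_ord sum_delta_l -[X in _ - X]/(\sum_k _).
  under [X in _ - X]eq_bigr => k _ do rewrite mulrC (Ginv_sym k)//.
  by rewrite GinvG// mulr_natl eq_sym addrK.
under eq_bigr => l _ do rewrite -mulr_suml tr -mulrA.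
by rewrite -mulr_sumr sum_delta_r.
Qed.

Lemma sum_ricci_principal x : U x ->
  \sum_i \sum_j Ginv x i j * ricci_principal i j x =
  (2 - 2 * n%:R) * \sum_k \sum_l Ginv x k l * pderiv k (pderiv l F) x.
Proof.
move=> Ux; apply: etrans (@sum_sym_trace (fun i j => Ginv x i j) (fun i j => G x i j)
    (fun i j => pderiv i (pderiv j F) x) _ _); last 2 first.
- by move=> i j; exact: Ginv_sym.
- by move=> i; rewrite (GinvG i i Ux) eqxx.
apply: eq_bigr => i _; apply: eq_bigr => j _.
by rewrite (ricci_principalE i j Ux).
Qed.

(** The remainder consists of [n] terms with [dF] times derivatives of the coefficients, and [n^2]
    terms quadratic in the connections with at least one factor [T], where [|T| <= b S]. *)
Lemma ricci_conformal_bound (b : R) i j x : U x -> 0 <= b ->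
  (forall k i j, `|christoffel G k i j x| <= b) ->
  (forall k i j l, `|t k i j l x| <= b) ->
  (forall m k i j l, `|pderiv m (t k i j l) x| <= b) ->
  `|ricci Gt i j x - ricci G i j x - ricci_principal i j x| <=
  (2 * n%:R * b + 4 * n%:R ^+ 2 * b ^+ 2) * (pderiv_norm F x + pderiv_norm F x ^+ 2).
Proof.
move=> Ux b0 Gb tb dtb; set S := pderiv_norm F x.
have S0 : 0 <= S by apply: sumr_ge0.
have sumS (u : 'I_n -> R) : (forall l, `|u l| <= b) ->
    `|\sum_l pderiv l F x * u l| <= b * S.
  move=> ub; apply: le_trans (ler_norm_sum _ _ _) _.
  rewrite mulr_sumr; apply: ler_sum => l _.
  by rewrite normrM mulrC ler_wpM2r.
have Tb k i' j' : `|T k i' j' x| <= b * S.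
  by rewrite /T; under eq_bigr do rewrite mulrC; exact: sumS.
pose D k := (\sum_l pderiv l F x * pderiv k (t k i j l) x) -
            (\sum_l pderiv l F x * pderiv j (t k i k l) x).
pose E k l := (christoffel G k k l x * T l i j x + T k k l x * christoffel G l i j x
  + T k k l x * T l i j x) - (christoffel G k j l x * T l i k x
  + T k j l x * christoffel G l i k x + T k j l x * T l i k x).
have -> : ricci Gt i j x - ricci G i j x - ricci_principal i j x =
    \sum_k D k + \sum_k \sum_l E k l.
  rewrite /ricci /ricci_principal opprD addrACA -!sumrB addrAC -sumrB.
  congr (_ + _); apply: eq_bigr => k _.
    rewrite (pderiv_christoffel_conformal k k i j Ux).
    rewrite (pderiv_christoffel_conformal j k i k Ux).
    rewrite (pderiv_christoffel_diff k k i j Ux) (pderiv_christoffel_diff j k i k Ux).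
    rewrite sumrB !big_split/=; exact: ricci_linear_part.
  rewrite -sumrB; apply: eq_bigr => l _.
  rewrite (christoffel_conformal k k l Ux) (christoffel_conformal l i j Ux).
  rewrite (christoffel_conformal k j l Ux) (christoffel_conformal l i k Ux).
  exact: ricci_product_part.
have Db k : `|D k| <= 2 * b * S.
  apply: le_trans (ler_normB _ _) _; rewrite -mulrA mulr2n mulrDl mul1r.
  by apply: lerD; exact: sumS.
have Eb k l : `|E k l| <= 4 * b ^+ 2 * (S + S ^+ 2).
  have gT k1 i1 j1 k2 i2 j2 :
      `|christoffel G k1 i1 j1 x * T k2 i2 j2 x| <= b ^+ 2 * S.
    by rewrite normrM expr2 -mulrA ler_pM.
  have TT k1 i1 j1 k2 i2 j2 : `|T k1 i1 j1 x * T k2 i2 j2 x| <= b ^+ 2 * S ^+ 2.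
    by rewrite normrM -exprMn expr2 ler_pM.
  have H (p q r : R) : `|p| <= b ^+ 2 * S -> `|q| <= b ^+ 2 * S ->
      `|r| <= b ^+ 2 * S ^+ 2 -> `|p + q + r| <= 2 * (b ^+ 2 * S) + b ^+ 2 * S ^+ 2.
    move=> hp hq hr; apply: le_trans (ler_normD _ _) _; apply: lerD hr.
    by apply: le_trans (ler_normD _ _) _; rewrite mulr2n mulrDl mul1r lerD.
  apply: le_trans (ler_normB _ _) _.
  apply: (@le_trans _ _ (2 * (2 * (b ^+ 2 * S) + b ^+ 2 * S ^+ 2))).
    by rewrite [X in X * (_ + _)]mulr2n [leRHS]mulrDl mul1r lerD//; apply: H => //;
      rewrite mulrC.
  have := mulr_ge0 (sqr_ge0 b) (sqr_ge0 S); lra.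
apply: le_trans (ler_normD _ _) _.
have := ler_norm_sum_const Db.
have := ler_norm_sum_const (fun k => ler_norm_sum_const (Eb k)).
have : 0 <= n%:R * (2 * b * S ^+ 2) by rewrite !mulr_ge0// sqr_ge0.
rewrite !expr2; lra.
Qed.

End Factor.

(** Multiplying by [e^(2F)] cancels the factor in the inverse metric, so [C] can be fixed before
    [F]. The bound on the curvature of [G] will control the zeroth-order term
    [R_gbar (1 - e^(2F))]. *)
Lemma conformal_scalar_curvature_bound K : compact K -> K `<=` U ->
  exists C : R, [/\ 0 <= C, forall x, K x -> `|scalar_curvature_coord G x| <= C &
    forall F, C2 U F -> forall x, K x ->
    `|scalar_curvature_coord (conformal_metric F) x * expR (2 * F x)
      - scalar_curvature_coord G x
      + (2 * n%:R - 2) * \sum_i \sum_j Ginv x i j * pderiv i (pderiv j F) x| <=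
    C * (pderiv_norm F x + pderiv_norm F x ^+ 2)].
Proof.
move=> cK KU.
have [b1 b10 b1P] := @bounded_family ('I_n * 'I_n * 'I_n)%type
  (fun i => christoffel G i.1.1 i.1.2 i.2) K cK
  (fun i x Kx => C1_continuous (C1_christoffel i.1.1 i.1.2 i.2) (KU x Kx)).
have [b2 b20 b2P] := @bounded_family ('I_n * 'I_n * 'I_n * 'I_n)%type
  (fun i => christoffel_coef i.1.1.1 i.1.1.2 i.1.2 i.2) K cK
  (fun i x Kx => C1_continuous (C1_christoffel_coef i.1.1.1 i.1.1.2 i.1.2 i.2) (KU x Kx)).
have [b3 b30 b3P] := @bounded_family ('I_n * 'I_n * 'I_n * 'I_n * 'I_n)%type
  (fun i => pderiv i.2 (christoffel_coef i.1.1.1.1 i.1.1.1.2 i.1.1.2 i.1.2)) K cK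
  (fun i x Kx => C1_pderiv_continuous (i := i.2)
    (C1_christoffel_coef i.1.1.1.1 i.1.1.1.2 i.1.1.2 i.1.2) (KU x Kx)).
have [b4 b40 b4P] := @bounded_family ('I_n * 'I_n)%type
  (fun i x => Ginv x i.1 i.2) K cK
  (fun i x Kx => C1_continuous (C1_Ginv i.1 i.2) (KU x Kx)).
have [b5 b50 b5P] := @bounded_family unit (fun=> scalar_curvature_coord G) K cK
  (fun i x Kx => continuous_scalar_curvature_coord (KU x Kx)).
pose b := b1 + b2 + b3.
have b0 : 0 <= b by rewrite !addr_ge0.
pose C := 2 * n%:R * b + 4 * n%:R ^+ 2 * b ^+ 2.
have C0 : 0 <= C by rewrite addr_ge0// !mulr_ge0// sqr_ge0.
exists (b5 + n%:R * (n%:R * (b4 * C))); split.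
- by rewrite addr_ge0// !mulr_ge0.
- move=> x Kx; apply: le_trans (b5P tt x Kx) _.
  by rewrite lerDl !mulr_ge0.
move=> F cF x Kx; have Ux := KU x Kx; set S := _ + _ ^+ 2.
have S0 : 0 <= S by rewrite addr_ge0 ?sqr_ge0//; apply: sumr_ge0.
have ric i j : `|ricci (conformal_metric F) i j x - ricci G i j x
    - ricci_principal F i j x| <= C * S.
  apply: ricci_conformal_bound => //.
  - move=> k i' j'; apply: le_trans (b1P (k, i', j') x Kx) _; rewrite /b; lra.
  - move=> k i' j' l; apply: le_trans (b2P (k, i', j', l) x Kx) _; rewrite /b; lra.
  - move=> m k i' j' l; apply: le_trans (b3P (k, i', j', l, m) x Kx) _; rewrite /b; lra.
have -> : scalar_curvature_coord (conformal_metric F) x * expR (2 * F x)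
      - scalar_curvature_coord G x
      + (2 * n%:R - 2) * (\sum_i \sum_j Ginv x i j * pderiv i (pderiv j F) x) =
  \sum_i \sum_j Ginv x i j * (ricci (conformal_metric F) i j x - ricci G i j x
    - ricci_principal F i j x).
  have -> : \sum_i \sum_j Ginv x i j * (ricci (conformal_metric F) i j x - ricci G i j x
    - ricci_principal F i j x) =
    \sum_i \sum_j Ginv x i j * ricci (conformal_metric F) i j x -
    \sum_i \sum_j Ginv x i j * ricci G i j x -
    \sum_i \sum_j Ginv x i j * ricci_principal F i j x.
    rewrite -!sumrB; apply: eq_bigr => i _; rewrite -!sumrB.
    by apply: eq_bigr => j _; ring.
  rewrite sum_ricci_principal// /scalar_curvature_coord.
  have -> : (\sum_i \sum_j invmx (conformal_metric F x) i j *
      ricci (conformal_metric F) i j x) * expR (2 * F x) =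
      \sum_i \sum_j Ginv x i j * ricci (conformal_metric F) i j x.
    rewrite mulr_suml; apply: eq_bigr => i _; rewrite mulr_suml; apply: eq_bigr => j _.
    have en0 : expR (2 * F x) != 0 by rewrite gt_eqF// expR_gt0.
    by rewrite invmx_conformal_metric//; field.
  ring.
have H i j : `|Ginv x i j * (ricci (conformal_metric F) i j x - ricci G i j x
    - ricci_principal F i j x)| <= b4 * (C * S).
  by rewrite normrM ler_pM//; exact: (b4P (i, j)).
apply: le_trans (ler_norm_sum_const (fun i => ler_norm_sum_const (H i))) _.
have -> : n%:R * (n%:R * (b4 * (C * S))) = n%:R * (n%:R * (b4 * C)) * S by ring.
by rewrite ler_wpM2r// lerDr.
Qed.

End ConformalCurvature.

(** * Length of curves and geodesic balls *)

Section TotalVariation.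
Context {R : realType}.
Local Notation mu := (@lebesgue_measure R).
Implicit Types (y : R -> R) (a b : R) (s : seq R).

(** The integral of a nonnegative function is a supremum over simple functions below it, hence
    monotone even for integrands not known to be measurable, such as [speed]. *)
Lemma ge0_le_integral_subset d (T : measurableType d) (m : {measure set T -> \bar R})
    (A B : set T) (f g : T -> \bar R) : A `<=` B ->
  (forall x, A x -> (0 <= f x)%E) -> (forall x, B x -> (0 <= g x)%E) ->
  (forall x, A x -> (f x <= g x)%E) ->
  (\int[m]_(x in A) f x <= \int[m]_(x in B) g x)%E.
Proof.
move=> AB f0 g0 fg; rewrite !ge0_integralE//=.
apply: ge_ereal_sup => _ [h/= hf <-]; apply: ereal_sup_ubound; exists h => //= x.
apply: le_trans (hf x) _; rewrite /patch.
case: ifPn => [/set_mem Ax|_]; first by rewrite mem_set ?fg//; exact: AB.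
by case: ifPn => // /set_mem /g0.
Qed.

Definition C1_off s y a b := forall t, a < t < b -> t \notin s ->
  derivable y t 1 /\ {for t, continuous (derive1 y)}.

Lemma dist_le_integral_closed y a b : a < b ->
  (forall t, a <= t <= b -> derivable y t 1 /\ {for t, continuous (derive1 y)}) ->
  (`|y b - y a|%:E <= \int[mu]_(t in `[a, b]) `|derive1 y t|%:E)%E.
Proof.
move=> ab dy.
have cdy : {within `[a, b], continuous (derive1 y)}.
  apply: continuous_in_subspaceT => t /set_mem/=; rewrite in_itv/= => /dy[].
  by [].
have cy t : a <= t <= b -> {for t, continuous y}.
  by move=> /dy[/derivable1_diffP/differentiable_continuous].
have E := @continuous_FTC2 R (derive1 y) y a b ab cdy.
have {}E : (\int[mu]_(t in `[a, b]) (derive1 y t)%:E = (y b)%:E - (y a)%:E)%E.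
  apply: E => //; split.
  - by move=> t; rewrite in_itv/= => /andP[/ltW at' /ltW tb]; apply: (dy t _).1; rewrite at' tb.
  - by apply: cvg_at_right_filter; apply: cy; rewrite lexx ltW.
  - by apply: cvg_at_left_filter; apply: cy; rewrite lexx ltW.
have mdy : measurable_fun `[a, b] (derive1 y).
  exact: subspace_continuous_measurable_fun.
have -> : `|y b - y a|%:E = `| \int[mu]_(t in `[a, b]) (derive1 y t)%:E |%E by rewrite E.
by apply: le_abse_integral => //; exact/measurable_EFinP.
Qed.

(** The derivative is not controlled at the end points: the estimate is taken on slightly smaller
    closed intervals, and continuity of [y] closes the gap. *)
Lemma dist_le_integral_open y a b : a < b -> {within `[a, b], continuous y} ->
  C1_off [::] y a b ->
  (`|y b - y a|%:E <= \int[mu]_(t in `]a, b[) `|derive1 y t|%:E)%E.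
Proof.
move=> ab /(continuous_within_itvP _ ab)[_ ya yb] dy.
set I := (X in (_ <= X)%E).
have I0 : (0 <= I)%E by apply: integral_ge0.
have [->|Ioo] := eqVneq I +oo%E; first by rewrite leey.
have IE : I = (fine I)%:E by rewrite fineK// ge0_fin_numE// ltey.
rewrite IE lee_fin; apply/ler_addgt0Pr => e e0.
have e2 : 0 < e / 2 by rewrite divr_gt0.
pose m := (a + b) / 2.
have am : a < m by rewrite /m; lra.
have mb : m < b by rewrite /m; lra.
have [a' [aa' a'm ya']] : exists a', [/\ a < a', a' < m & `|y a - y a'| <= e / 2].
  have H : \forall t \near a^'+, `|y a - y t| <= e / 2.
    by move/cvgrPdist_le : ya => /(_ _ e2).
  near (a^'+) => a'; exists a'; split; near: a' => //.
  - exact: nbhs_right_gt.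
  - exact: nbhs_right_lt.
have [b' [bb' b'm yb']] : exists b', [/\ b' < b, m < b' & `|y b - y b'| <= e / 2].
  have H : \forall t \near b^'-, `|y b - y t| <= e / 2.
    by move/cvgrPdist_le : yb => /(_ _ e2).
  near (b^'-) => b'; exists b'; split; near: b' => //.
  - exact: nbhs_left_lt.
  - exact: nbhs_left_gt.
have : (`|y b' - y a'|%:E <= I)%E.
  apply: le_trans (dist_le_integral_closed _ _) _.
  - exact: lt_trans a'm b'm.
  - move=> t /andP[a't tb']; apply: dy => //.
    by rewrite (lt_le_trans aa' a't) (le_lt_trans tb' bb').
  apply: ge0_le_integral_subset => // t/=; rewrite !in_itv/= => /andP[a't tb'].
  by rewrite (lt_le_trans aa' a't) (le_lt_trans tb' bb').
rewrite IE lee_fin => H.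
have -> : y b - y a = (y b - y b') + (y b' - y a') - (y a - y a') by ring.
apply: le_trans (ler_normB _ _) _; apply: le_trans (lerD (ler_normD _ _) (lexx _)) _.
lra.
Unshelve. all: by end_near. Qed.

Lemma open_itvoo_off s a b : open (`]a, b[ `\` [set` s]).
Proof.
rewrite setDE; apply: openI; first exact: itv_open.
apply: closed_openC.
apply: (accessible_finite_set_closed.1 (hausdorff_accessible (@Rhausdorff R))).
exact: finite_seq.
Qed.

Lemma measurable_C1_off s y a b : C1_off s y a b ->
  measurable_fun (`]a, b[ `\` [set` s]) (fun t => `|derive1 y t|%:E).
Proof.
move=> dy; apply/measurable_EFinP; apply: measurableT_comp => //.
apply: open_continuous_measurable_fun; first exact: open_itvoo_off.
by move=> t /set_mem[/= tab /negP ts]; apply: (dy t _ _).2 => //; rewrite -in_itv.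
Qed.

(** Induction on the exceptional points: one inside []a, b[] splits the interval, any other is
    discarded. *)
Lemma dist_le_integral s y a b : a <= b -> {within `[a, b], continuous y} ->
  C1_off s y a b ->
  (`|y b - y a|%:E <= \int[mu]_(t in `]a, b[ `\` [set` s]) `|derive1 y t|%:E)%E.
Proof.
elim: s a b => [|e s IH] a b.
  rewrite le_eqVlt => /predU1P[<-|ab] cy dy.
    by rewrite subrr normr0; apply: integral_ge0.
  have -> : `]a, b[ `\` [set` [::]] = [set` `]a, b[].
    by apply/seteqP; split=> t // [].
  exact: dist_le_integral_open.
move=> ab cy dy.
have [/andP[ae eb]|eab] := boolP (a < e < b); last first.
  have -> : `]a, b[ `\` [set` (e :: s)] = `]a, b[ `\` [set` s].
    apply/seteqP; split=> t [tab ts]; split=> //= tes; apply: ts => /=.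
      by rewrite in_cons tes orbT.
    move: tes; rewrite in_cons => /predU1P[te|//].
    by move: tab; rewrite /= in_itv/= te (negbTE eab).
  apply: IH => // t tab ts; apply: dy => //; rewrite in_cons negb_or ts andbT.
  by apply: contraNneq eab => <-.
have sub1 : `]a, e[ `\` [set` s] `<=` `]a, b[ `\` [set` (e :: s)].
  move=> t []/=; rewrite !in_itv/= => /andP[at' te] ts; split.
    by rewrite at' (lt_trans te eb).
  by rewrite in_cons => /predU1P[tE|//]; move: te; rewrite tE ltxx.
have sub2 : `]e, b[ `\` [set` s] `<=` `]a, b[ `\` [set` (e :: s)].
  move=> t []/=; rewrite !in_itv/= => /andP[et tb] ts; split.
    by rewrite tb (lt_trans ae et).
  by rewrite in_cons => /predU1P[tE|//]; move: et; rewrite tE ltxx.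
have d1 : C1_off s y a e.
  move=> t /andP[at' te] ts; apply: dy; first by rewrite at' (lt_trans te eb).
  by rewrite in_cons negb_or ts andbT lt_eqF.
have d2 : C1_off s y e b.
  move=> t /andP[et tb] ts; apply: dy; first by rewrite tb (lt_trans ae et).
  by rewrite in_cons negb_or ts andbT gt_eqF.
have c1 : {within `[a, e], continuous y}.
  apply: continuous_subspaceW cy => t/=; rewrite !in_itv/= => /andP[-> te]/=.
  exact: le_trans te (ltW eb).
have c2 : {within `[e, b], continuous y}.
  apply: continuous_subspaceW cy => t/=; rewrite !in_itv/= => /andP[et ->].
  by rewrite (le_trans (ltW ae) et).
have I1 := IH a e (ltW ae) c1 d1; have I2 := IH e b (ltW eb) c2 d2.
apply: (@le_trans _ _ (`|y e - y a|%:E + `|y b - y e|%:E)%E).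
  rewrite -EFinD lee_fin; have -> : y b - y a = (y e - y a) + (y b - y e) by ring.
  exact: ler_normD.
apply: le_trans (leeD I1 I2) _.
rewrite -ge0_integral_setU//.
- by apply: ge0_le_integral_subset => // t [/sub1|/sub2].
- by apply: open_measurable; exact: open_itvoo_off.
- by apply: open_measurable; exact: open_itvoo_off.
- by apply/measurable_funU; [apply: open_measurable; exact: open_itvoo_off..|split; exact: measurable_C1_off].
- apply/disj_setPS => t [[/=]]; rewrite !in_itv/= => /andP[_ te] _ [/andP[et _] _].
  by have := lt_trans te et; rewrite ltxx.
Qed.

End TotalVariation.

(** * Small geodesic balls lie in coordinate balls *)

Section GeodesicBall.
Context {R : realType} {n : nat}.

Lemma derive1_coord (u : R -> 'rV[R]_n) i t : derivable u t 1 ->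
  derivable (fun x => u x 0 i) t 1 /\ derive1 (fun x => u x 0 i) t = (derive1 u t) 0 i.
Proof.
move=> du; have /derivable_mxP/(_ 0 i) dui := du; split=> //.
by rewrite !derive1E derive_mx// mxE.
Qed.

(** The infimum of the times spent outside [V] is attained, because [V] is open and the curve is
    continuous. *)
Lemma first_exit_time (T : topologicalType) (gam : R -> T) (V : set T) :
  open V -> {within `[0, 1], continuous gam} -> V (gam 0) -> ~ V (gam 1) ->
  exists t1, [/\ 0 < t1 <= 1, ~ V (gam t1) & forall t, 0 <= t < t1 -> V (gam t)].
Proof.
move=> oV /subspace_continuousP cgam V0 V1.
pose S := [set t : R | 0 <= t <= 1 /\ ~ V (gam t)].
have S1 : S 1 by split=> //; rewrite lexx ler01.
have lbS : lbound S 0 by move=> t [/andP[]].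
have hS : has_lbound S by exists 0.
pose t1 := inf S.
have t11 : t1 <= 1 by exact: ge_inf.
have t10 : 0 <= t1 by apply: lb_le_inf => //; exists 1.
have before t : 0 <= t < t1 -> V (gam t).
  move=> /andP[t0 tt1]; apply: contrapT => NV.
  have : t1 <= t by apply: ge_inf => //; split=> //; rewrite t0 (le_trans (ltW tt1)).
  by rewrite leNgt tt1.
have NV1 : ~ V (gam t1).
  move=> Vt1.
  have t1i : `[0, 1]%classic t1 by rewrite /= in_itv/= t10 t11.
  have /(cgam _ t1i) : nbhs (gam t1) V by exact: open_nbhs_nbhs.
  move=> [e /= e0 eV].
  have : t1 + e <= t1.
    apply: lb_le_inf; first by exists 1.
    move=> t [t01 NVt]; rewrite leNgt; apply/negP => tlt.
    have t1t : t1 <= t by apply: ge_inf.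
    apply: NVt.
    have bt : ball t1 e t by rewrite /ball/= distrC ger0_norm ?subr_ge0// ltrBlDl.
    have ti : t \in `[0, 1] by rewrite in_itv.
    exact: (eV t bt ti).
  by rewrite gerDl leNgt e0.
exists t1; split=> //; rewrite t11 andbT lt0r t10 andbT.
by apply/eqP => t1E; apply: NV1; rewrite t1E.
Qed.

Variable (M : smooth_manifold R n) (g : riemannian_metric M) (p : M) (c : chart M).
Hypotheses (n_gt0 : (0 < n)%N) (cp : dom c p).
Local Notation x0 := (phi c p).

Lemma speed_ge0 gam t : (0 <= speed g gam t)%E.
Proof.
have [c' dc'] := dom_cover (gam t).
apply: le_trans (ereal_sup_ubound _); last by exists c'; [exact: dc'|reflexivity].
by rewrite lee_fin sqrtr_ge0.
Qed.

Lemma chart_ball_open d : open [set q | dom c q /\ sqnorm (phi c q - x0) < d].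
Proof.
rewrite openE => q [dq sq]; rewrite /interior.
have : \forall q' \near q, sqnorm (phi c q' - x0) < d.
  have cphi := @phi_continuous _ _ M c q dq.
  apply: (cphi [set x | sqnorm (x - x0) < d]).
  by apply: open_nbhs_nbhs; split; [exact: open_sqball|].
have : \forall q' \near q, dom c q' by apply: open_nbhs_nbhs; split=> //; exact: dom_open.
by apply: filterS2.
Qed.

(** A curve leaving the coordinate ball has by then moved some coordinate by at least [l], and
    inside the ball its speed dominates [k] times the derivative of that coordinate. One coordinate
    suffices and makes the length estimate scalar. *)
Lemma geodesic_ball_sub_chart (d lam : R) : 0 < d -> 0 < lam ->
  (forall x, sqnorm (x - x0) <= d -> cod c x) ->
  (forall x v, sqnorm (x - x0) <= d -> lam * sqnorm v <= qform (g c (psi c x)) v) ->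
  exists2 r0, 0 < r0 &
    forall q, geodesic_ball g p r0 q -> dom c q /\ sqnorm (phi c q - x0) < d.
Proof.
move=> d0 lam0 Dcod ell.
pose D := [set x | sqnorm (x - x0) <= d].
pose V := [set q | dom c q /\ sqnorm (phi c q - x0) < d].
pose k := Num.sqrt lam.
have k0 : 0 < k by rewrite sqrtr_gt0.
pose l := Num.sqrt (d / (2 * n%:R)).
(* If all squared coordinates were below [d / (2 n)], their sum would be at most [d / 2], which is
   impossible on the sphere [sqnorm = d]. *)
have l20 : 0 < d / (2 * n%:R) by rewrite divr_gt0// mulr_gt0// ltr0n.
have l0 : 0 < l by rewrite sqrtr_gt0.
exists (k * l); first exact: mulr_gt0.
move=> q; rewrite /geodesic_ball/= => /ereal_inf_lt[_ [gam [[cgam [s sP]] gam0 gam1 ->]]].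
rewrite /curve_length => short; apply: contrapT => NVq.
have [||t1 [/andP[t10 t11] NVt1 before]] :=
    first_exit_time (chart_ball_open d) cgam.
- by rewrite gam0; split=> //; rewrite subrr /sqnorm big1// => i _; rewrite mxE expr0n.
- by rewrite gam1.
(* The curve cannot leave the chart without meeting the sphere: [gam t1] is a limit of points in the
   image of the closed ball, which is compact, hence closed in the Hausdorff space [M]. *)
have [x [Dx gx]] : (psi c @` D) (gam t1).
  have cpsi : {within D, continuous (psi c)}.
    apply: continuous_in_subspaceT => x /set_mem /Dcod; exact: psi_continuous.
  have : closed (psi c @` D).
    apply: compact_closed; first exact: manifold_hausdorff.
    exact: (continuous_compact cpsi (@compact_sqball R n x0 d)).
  apply => W; move/subspace_continuousP : cgam => /(_ t1).
  rewrite /= in_itv/= t11 (ltW t10) => /(_ isT) /[apply] -[e /= e0 eW].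
  pose t := Num.max 0 (t1 - e / 2).
  have t0 : 0 <= t by rewrite le_max lexx.
  have tt1 : t < t1 by rewrite gt_max t10 ltrBlDr ltrDl divr_gt0.
  have te : t1 - e / 2 <= t by rewrite le_max lexx orbT.
  have [dt st] : V (gam t) by apply: before; rewrite t0.
  exists (gam t); split.
    by exists (phi c (gam t)); [exact: ltW|exact: phiK].
  have bt : ball t1 e t.
    by rewrite /ball/= ger0_norm ?subr_ge0 ?ltW//; move: te e0; lra.
  have ti : t \in `[0, 1] by rewrite in_itv/= t0 (le_trans (ltW tt1)).
  exact: (eW t bt ti).
have dt1 : dom c (gam t1) by rewrite -gx; apply/psi_dom/Dcod.
have px : phi c (gam t1) = x by rewrite -gx psiK//; exact: Dcod.
have xd : sqnorm (x - x0) = d.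
  by apply: le_anti; rewrite Dx leNgt; apply/negP => xd; apply: NVt1; split; rewrite ?px.
have inD t : 0 <= t <= t1 -> dom c (gam t) /\ D (phi c (gam t)).
  move=> /andP[t0]; rewrite le_eqVlt => /predU1P[->|tt1]; first by split; rewrite ?px.
  by have [|? /ltW] := before t; [rewrite t0|].
have [i xi] : exists i, d / (2 * n%:R) <= (x - x0) 0 i ^+ 2.
  apply: contrapT => /forallNP H.
  have : sqnorm (x - x0) <= \sum_(i < n) d / (2 * n%:R).
    by apply: ler_sum => i _; have /negP := H i; rewrite -ltNge => /ltW.
  rewrite xd sumr_const card_ord -[_ *+ n]mulr_natl.
  have -> : n%:R * (d / (2 * n%:R)) = d / 2 by field; rewrite pnatr_eq0 -lt0n n_gt0.
  by move: d0; lra.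
pose u := phi c \o gam.
pose y t := k * u t 0 i.
have cy : {within `[0, t1], continuous y}.
  apply/subspace_continuousP => t /=; rewrite in_itv/= => /andP[t0 tt1].
  have [dgt _] : dom c (gam t) /\ D (phi c (gam t)) by apply: inD; rewrite t0.
  have cg : gam z @[z --> within `[0, t1] (nbhs t)] --> gam t.
    move/subspace_continuousP : cgam => /(_ t).
    rewrite /= in_itv/= t0 (le_trans tt1 t11) => /(_ isT); apply: cvg_trans.
    apply: cvg_app; apply: within_subset => z /=; rewrite !in_itv/= => /andP[-> zt1].
    exact: le_trans zt1 t11.
  have cphi := @phi_continuous _ _ M c _ dgt.
  have cu : u z @[z --> within `[0, t1] (nbhs t)] --> u t by exact: (cvg_comp _ _ cg cphi).
  have cc := @coord_continuous R 1 n 0 i (u t).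
  apply: cvgM; first exact: cvg_cst.
  exact: (cvg_comp _ _ cu cc).
have t1_1 t : t < t1 -> t < 1 by move=> /lt_le_trans; apply.
have du t : 0 < t < t1 -> t \notin s -> derivable u t 1 /\ {for t, continuous (derive1 u)}.
  move=> /andP[t0 tt1] ts.
  have [dgt _] : dom c (gam t) /\ D (phi c (gam t)) by apply: inD; rewrite !ltW.
  have [|H _ _] := sP t c _ dgt; first by rewrite !ltW// t1_1.
  by apply: H => //; rewrite t0 t1_1.
have dyE t : 0 < t < t1 -> t \notin s ->
    derivable y t 1 /\ derive1 y t = k * (derive1 u t) 0 i.
  move=> t01 ts; have [dut _] := du t t01 ts.
  have [dui E] := derive1_coord i dut.
  split; first exact: (derivableM (@derivable_cst _ _ _ k t 1) dui).
  by rewrite -E derive1Ml.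
have C1y : C1_off s y 0 t1.
  move=> t t01 ts; split; first by have [] := dyE t t01 ts.
  have cu : {for t, continuous (fun z => k * (derive1 u z) 0 i)}.
    have [_ cu] := du t t01 ts.
    have cc := @coord_continuous R 1 n 0 i (derive1 u t).
    have := cvg_comp _ _ cu cc => cuc.
    rewrite /prop_for /continuous_at; apply: cvgM; first exact: cvg_cst.
    exact: cuc.
  have E : \forall z \near t, k * (derive1 u z) 0 i = derive1 y z.
    have : (`]0, t1[ `\` [set` s]) t.
      by split; [rewrite /= in_itv|apply/negP].
    move=> H; have := open_nbhs_nbhs (conj (@open_itvoo_off R s 0 t1) H).
    apply: filterS => z [/=]; rewrite in_itv/= => z01 /negP zs.
    by have [_ ->] := dyE z z01 zs.
  have Et := nbhs_singleton E.
  rewrite /prop_for /continuous_at -Et; apply: cvg_trans cu.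
  exact: (near_eq_cvg E).
(* [speed] is a supremum over charts, so the chart [c] alone bounds it from below. *)
have length_ge : (\int[lebesgue_measure]_(t in `]0%R, t1[ `\` [set` s]) `|derive1 y t|%:E <=
    \int[lebesgue_measure]_(t in `[0%R, 1%R]) speed g gam t)%E.
  apply: ge0_le_integral_subset.
  - move=> t [/=]; rewrite !in_itv/= => /andP[t0 tt1] _.
    by rewrite !ltW// t1_1.
  - by move=> t _; rewrite lee_fin.
  - by move=> t _; exact: speed_ge0.
  - move=> t [/=]; rewrite in_itv/= => t01 /negP ts.
    have [_ ->] := dyE t t01 ts.
    have [dgt Dt] : dom c (gam t) /\ D (phi c (gam t)).
      by apply: inD; case/andP: t01 => ? ?; rewrite !ltW.
    apply: le_trans (ereal_sup_ubound _); last by exists c; [exact: dgt|reflexivity].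
    rewrite lee_fin normrM (gtr0_norm k0).
    have -> : k * `|derive1 u t 0 i| = Num.sqrt (lam * derive1 u t 0 i ^+ 2).
      by rewrite sqrtrM ?sqrtr_sqr// ltW.
    apply: ler_wsqrtr; apply: le_trans (_ : lam * sqnorm (derive1 u t) <= _).
      by rewrite ler_pM2l//; exact: sqr_coord_le_sqnorm.
    by have := ell _ (derive1 u t) Dt; rewrite phiK.
have dist_ge : ((k * l)%:E <= `|y t1 - y 0|%:E)%E.
  rewrite lee_fin /y -mulrBr normrM (gtr0_norm k0) ler_pM2l//.
  rewrite /u /= px gam0 /l -sqrtr_sqr ler_wsqrtr//.
  by apply: le_trans xi _; rewrite !mxE.
have := dist_le_integral (ltW t10) cy C1y.
by apply/negP; rewrite -ltNge (le_lt_trans length_ge)// (lt_le_trans short).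
Qed.

End GeodesicBall.

(** * Rigidity *)

Section Rigidity.
Context {R : realType} {n : nat}.

Lemma smooth_on_C2 (U : set 'rV[R]_n) (f : 'rV[R]_n -> R) : smooth_on U f -> C2 U f.
Proof.
move=> sf; split=> [x Ux|i x Ux].
  have [cf df] := sf [::] x Ux; split; first exact: cf.
  by move=> j; have [cj _] := sf [:: j] x Ux; exact: conj (df j) cj.
have [cf df] := sf [:: i] x Ux; split; first exact: cf.
by move=> j; have [cj _] := sf [:: j; i] x Ux; exact: conj (df j) cj.
Qed.

Lemma smooth_on_cst (U : set 'rV[R]_n) (k : R) : smooth_on U (fun=> k).
Proof.
have E (s : seq 'I_n) : exists l : R, foldr pderiv (fun=> k : R) s = fun=> l.
  elim: s => [|i s [l IH]]; first by exists k.
  by exists 0 => /=; rewrite IH; apply/funext => x; exact: derive_cst.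
move=> s x _; have [l ->] := E s; split; first exact: cst_continuous.
by move=> i; exact: derivable_cst.
Qed.

Lemma eq_christoffel (U : set 'rV[R]_n) (G H : 'rV[R]_n -> 'M[R]_n) k i j x : open U ->
  (forall y, U y -> G y = H y) -> U x -> christoffel G k i j x = christoffel H k i j x.
Proof.
move=> oU GH Ux; rewrite /christoffel (GH x Ux); congr (_ * _); apply: eq_bigr => l _.
have E m a b : pderiv m (fun y => G y a b) x = pderiv m (fun y => H y a b) x.
  by apply: (eq_pderiv (U := U)) => // y Uy; rewrite GH.
by rewrite (E i j l) (E j i l) (E l i j).
Qed.

(** Curvature depends only on the germ of the metric, and the formula for [g] in coordinates holds
    only on the chart. *)
Lemma eq_scalar_curvature_coord (U : set 'rV[R]_n) (G H : 'rV[R]_n -> 'M[R]_n) x :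
  open U -> (forall y, U y -> G y = H y) -> U x ->
  scalar_curvature_coord G x = scalar_curvature_coord H x.
Proof.
move=> oU GH Ux; rewrite /scalar_curvature_coord (GH x Ux).
apply: eq_bigr => i _; apply: eq_bigr => j _; congr (_ * _).
have E k a b : christoffel G k a b x = christoffel H k a b x by exact: eq_christoffel GH Ux.
have dE m k a b : pderiv m (christoffel G k a b) x = pderiv m (christoffel H k a b) x.
  by apply: (eq_pderiv (U := U)) => // y Uy; exact: eq_christoffel GH Uy.
apply: (f_equal2 +%R); apply: eq_bigr => k _.
  exact: (f_equal2 (fun a b => a - b) (dE k k i j) (dE j k i k)).
apply: eq_bigr => l _.
exact: (f_equal2 (fun a b => a - b)
  (f_equal2 *%R (E k k l) (E l i j)) (f_equal2 *%R (E k j l) (E l i k))).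
Qed.

Lemma C2_opp (U : set 'rV[R]_n) (F : 'rV[R]_n -> R) : open U -> C2 U F ->
  [/\ C2 U (fun x => - F x),
      forall i x, U x -> pderiv i (fun x => - F x) x = - pderiv i F x &
      forall i j x, U x ->
        pderiv i (pderiv j (fun x => - F x)) x = - pderiv i (pderiv j F) x].
Proof.
move=> oU cF.
have d1 i x : U x -> pderiv i (fun x => - F x) x = - pderiv i F x.
  by move=> Ux; apply: pderivE; exact: is_deriveN (C1_pderiv i cF.1 Ux).
split; last 2 first.
- exact: d1.
- move=> i j x Ux; apply: etrans (eq_pderiv i oU (d1 j) Ux) _.
  by apply: pderivE; exact: is_deriveN (C1_pderiv i (cF.2 j) Ux).
- split=> [|i]; first by apply: C1N oU cF.1.
  by apply: eq_C1 oU _ (C1N oU (cF.2 i)) => x Ux; exact: esym (d1 i x Ux).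
Qed.

(** Everything follows from [e^s >= 1 + s] at [s = 2t] and [s = -2t], with [e^(2t)] between 1/2 and
    3/2; the 3 is twice the upper bound. *)
Lemma expR2_bounds (t : R) : `|expR (2 * t) - 1| < 2^-1 ->
  `|t| <= 1 /\ `|expR (2 * t) - 1| <= 3 * `|t|.
Proof.
move=> H; have /ltr_normlP[H1 H2] := H.
have ge1 := expR_ge1Dx (2 * t); have ge2 := expR_ge1Dx (- (2 * t)).
have e0 : 0 < expR (2 * t) by exact: expR_gt0.
rewrite expRN in ge2.
move: ge1 ge2 H1 H2 e0; set E := expR _ => ge1 ge2 H1 H2 e0.
have {}ge2 : (1 - 2 * t) * E <= 1.
  by move: ge2; rewrite -(ler_pM2r e0) mulVf ?gt_eqF// .
have E2 : E <= 3 / 2 by lra.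
have E1 : 2^-1 <= E by lra.
have tlo : - 1 <= t by nra.
have thi : t <= 1 by lra.
split; first by rewrite ler_norml tlo thi.
rewrite ler_norml; have [t0|t0] := ger0P t.
  by have := ler_wpM2l t0 E2; move: ge1 ge2 t0 => *; apply/andP; split; lra.
by have := mulr_le0_ge0 (ltW t0) (ltW e0) => *; apply/andP; split; lra.
Qed.

Lemma closed_sqball_sub (U : set 'rV[R]_n) x0 : open U -> U x0 ->
  exists2 d : R, 0 < d & forall x, sqnorm (x - x0) <= d -> U x.
Proof.
move=> oU Ux0; have /nbhs_ballP[r /= r0 rU] := open_nbhs_nbhs (conj oU Ux0).
exists ((r / 2) ^+ 2) => [|x xr]; first by rewrite exprn_gt0// divr_gt0.
apply: rU; rewrite -ball_normE /= distrC.
apply: le_lt_trans (norm_le_sqnorm _ xr) _; first by rewrite divr_ge0// ltW.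
by rewrite ltr_pdivrMr// ltr_pMr// ltr1n.
Qed.

Variables (M : smooth_manifold R n) (gbar : riemannian_metric M).

Lemma metric_posdef c q : dom c q -> posdef (gbar c q).
Proof.
by move=> dq; split; [exact: (Defs.metric_sym gbar dq)|move=> v; exact: (metric_pos gbar dq)].
Qed.

Lemma tensor_support_eq (g : riemannian_metric M) q c :
  ~ tensor_support (tensor_sub g gbar) q -> dom c q -> g c q = gbar c q.
Proof.
move=> Nq dq; apply: contrapT => gq; apply: Nq; apply: subset_closure.
exists c => // /eqP; rewrite /tensor_sub subr_eq0 => /eqP; exact: gq.
Qed.

Lemma conformal_factor_eq0 c q (t : R) : (0 < n)%N -> dom c q ->
  expR (2 * t) *: gbar c q = gbar c q -> t = 0.
Proof.
move=> n0 dq E.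
have v0 : (delta_mx 0 (Ordinal n0) : 'rV[R]_n) != 0.
  apply/eqP => /rowP/(_ (Ordinal n0)); rewrite !mxE !eqxx => /eqP.
  by rewrite oner_eq0.
have q0 := metric_pos gbar dq v0.
have : expR (2 * t) * qform (gbar c q) (delta_mx 0 (Ordinal n0)) =
    qform (gbar c q) (delta_mx 0 (Ordinal n0)).
  transitivity (qform (expR (2 * t) *: gbar c q) (delta_mx 0 (Ordinal n0))).
    by rewrite /qform -scalemxAr -scalemxAl [in RHS]mxE.
  by rewrite E.
move=> /eqP; rewrite -subr_eq0 -[X in _ - X]mul1r -mulrBl mulf_eq0 (gt_eqF q0) orbF.
rewrite subr_eq0 => /eqP e1.
have : 2 * t = 0 by apply: expR_inj; rewrite e1 expR0.
lra.
Qed.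

(** The norm of [(e^(2t) - 1) gbar] is [|e^(2t) - 1| sqrt n], and [sqrt n >= 1], so the threshold
    1/2 serves in every dimension. *)
Lemma conformal_C0norm_bound (g : riemannian_metric M) c q (t : R) : (0 < n)%N ->
  dom c q -> g c q = expR (2 * t) *: gbar c q ->
  (C0norm gbar (tensor_sub g gbar) < (2^-1)%:E)%E -> `|expR (2 * t) - 1| < 2^-1.
Proof.
move=> n0 dq gq small.
have : ((tensor_norm (gbar c q) (tensor_sub g gbar c q))%:E < (2^-1)%:E)%E.
  by apply: le_lt_trans small; apply: ereal_sup_ubound; exists c, q.
rewrite lte_fin /tensor_sub gq -[X in _ - X]scale1r -scalerBl.
rewrite tensor_norm_scale; last exact: metric_posdef.
apply: le_lt_trans; rewrite ler_peMr// -[leLHS]sqrtr1 ler_wsqrtr//.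
by rewrite ler1n.
Qed.

(** Compactness bounds the entries of the metric and of its inverse, and entry bounds for either
    matrix give ellipticity of the other. *)
Lemma chart_metric_bounds c (K : set 'rV[R]_n) : compact K -> K `<=` cod c ->
  exists lam Lam : R, [/\ 0 < lam,
    forall x v, K x -> lam * sqnorm v <= qform (gbar c (psi c x)) v,
    forall x v, K x -> lam * sqnorm v <= qform (invmx (gbar c (psi c x))) v &
    forall x, K x -> \tr (invmx (gbar c (psi c x))) <= Lam].
Proof.
move=> cK KU; pose G x := gbar c (psi c x).
have oU : open (cod c) by exact: cod_open.
have pG x : K x -> posdef (G x) by move=> /KU Ux; apply/metric_posdef/psi_dom.
have cG i j := (smooth_on_C2 (metric_smooth gbar (c := c) i j)).1.
have [b b0 bP] := @bounded_family R n ('I_n * 'I_n)%type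
  (fun i x => G x i.1 i.2) K cK (fun i x Kx => C1_continuous (cG i.1 i.2) (KU x Kx)).
have cGi i j : C1 (cod c) (fun x => invmx (G x) i j).
  by apply: C1_invmx => // x Ux; apply/posdef_unitmx/metric_posdef/psi_dom.
have [b' b'0 bP'] := @bounded_family R n ('I_n * 'I_n)%type
  (fun i x => invmx (G x) i.1 i.2) K cK
  (fun i x Kx => C1_continuous (cGi i.1 i.2) (KU x Kx)).
have bn : 0 <= (b + b') * n%:R by rewrite mulr_ge0// addr_ge0.
pose L := (b + b') * n%:R + 1.
have L0 : 0 < L by rewrite ltr_wpDl.
have key (A : 'M[R]_n) v : posdef A -> (forall i j, `|invmx A i j| <= b + b') ->
    L^-1 * sqnorm v <= qform A v.
  move=> pA Ab; rewrite mulrC ler_pdivrMr//.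
  apply: le_trans (sqnorm_le_qform v pA Ab) _.
  have q0 : 0 <= qform A v.
    have [->|/pA.2/ltW//] := eqVneq v 0.
    by rewrite /qform !mul0mx mxE.
  by rewrite /L mulrDr mulr1 [qform A v * _]mulrC lerDl.
exists L^-1, (\sum_(i < n) b'); split.
- by rewrite invr_gt0.
- move=> x v Kx; apply: key; first exact: pG.
  by move=> i j; apply: le_trans (bP' (i, j) x Kx) _; rewrite lerDr.
- move=> x v Kx; apply: key; first exact/posdef_invmx/pG.
  by move=> i j; rewrite invmxK; apply: le_trans (bP (i, j) x Kx) _; rewrite lerDl.
- move=> x Kx; apply: ler_sum => i _.
  by apply: le_trans (ler_norm _) _; exact: (bP' (i, i) x Kx).
Qed.

Lemma conformal_rigidity (p : M) : (2 <= n)%N ->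
  exists2 r0 : R, 0 < r0 & forall Omega : set M, Omega `<=` geodesic_ball gbar p r0 ->
    forall g : riemannian_metric M, conformal_class gbar g ->
      tensor_support (tensor_sub g gbar) `<=` Omega ->
      (C0norm gbar (tensor_sub g gbar) < (2^-1)%:E)%E ->
      scalar_curvature_le gbar g \/ scalar_curvature_le g gbar ->
      tensor_eq g gbar.
Proof.
move=> n2; have n0 : (0 < n)%N by exact: leq_trans n2.
have [c cp] := dom_cover p; pose x0 := phi c p.
pose U := cod c; have oU : open U by exact: cod_open.
have Ux0 : U x0 by exact: phi_cod.
have [d0 d00 DU] := closed_sqball_sub oU Ux0.
pose D0 := [set x | sqnorm (x - x0) <= d0].
have cD0 : compact D0 by exact: compact_sqball.
pose G x := gbar c (psi c x).
have G_C2 i j : C2 U (fun x => G x i j) by apply: smooth_on_C2; exact: metric_smooth.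
have G_pos x : U x -> posdef (G x) by move=> Ux; apply/metric_posdef/psi_dom.
have [lam [Lam [lam0 ellG ellGi trGi]]] := chart_metric_bounds cD0 DU.
have [C [C0 scalC confC]] := conformal_scalar_curvature_bound oU G_C2 G_pos cD0 DU.
(* The factor 3 comes from [|e^(2F) - 1| <= 3 |F|] in the zeroth-order term. *)
have C30 : 0 <= 3 * C by rewrite mulr_ge0.
have Gi_pos x : D0 x -> posdef (invmx (G x)) by move=> /DU/G_pos/posdef_invmx.
have [e [e0 ed0 eP]] := small_support_maximum_principle n0 oU DU d00 lam0 C30
  Gi_pos (fun x v => ellGi x v) trGi.
have e20 : 0 < e ^+ 2 by rewrite exprn_gt0.
have eD0 x : sqnorm (x - x0) <= e ^+ 2 -> D0 x.
  by move=> xe; rewrite /D0/=; move: xe ed0 e20; lra.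
have [r0 r00 r0P] := geodesic_ball_sub_chart n0 cp e20 lam0
  (fun x xe => DU x (eD0 x xe)) (fun x v xe => ellG x v (eD0 x xe)).
exists r0 => // Omega Or0 g [f sf gf] supp small scal.
pose F x := f (psi c x).
have F_C2 : C2 U F by apply: smooth_on_C2; exact: sf.
have gU x : U x -> g c (psi c x) = conformal_metric G F x.
  by move=> Ux; rewrite gf//; exact: psi_dom.
(* Off the coordinate ball the metrics agree in every chart, and a positive definite matrix
   determines its scalar factor. *)
have outside q : ~ (dom c q /\ sqnorm (phi c q - x0) < e ^+ 2) -> f q = 0.
  move=> Nq; have Nsupp : ~ tensor_support (tensor_sub g gbar) q.
    by move=> /supp/Or0/r0P.
  have [c' dq] := dom_cover q.
  apply: (@conformal_factor_eq0 c' q) => //.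
  by rewrite -gf//; exact: tensor_support_eq.
have bounds x : U x -> `|F x| <= 1 /\ `|expR (2 * F x) - 1| <= 3 * `|F x|.
  move=> Ux; apply: expR2_bounds.
  apply: (@conformal_C0norm_bound g c (psi c x)) => //; first exact: psi_dom.
  by apply: gf; exact: psi_dom.
have Fout x : D0 x -> e ^+ 2 <= sqnorm (x - x0) -> F x = 0.
  move=> Dx xe; apply: outside => -[_]; rewrite psiK; last exact: DU.
  by rewrite ltNge xe.
have scalg x : U x ->
    scalar_curvature g c (psi c x) = scalar_curvature_coord (conformal_metric G F) x.
  move=> Ux; rewrite /scalar_curvature psiK//.
  exact: (@eq_scalar_curvature_coord U).
have scalgbar x : U x -> scalar_curvature gbar c (psi c x) = scalar_curvature_coord G x.
  by move=> Ux; rewrite /scalar_curvature psiK.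
have n2R : 1 <= 2 * n%:R - 2 :> R.
  have : (2 : R) <= n%:R by rewrite ler_nat.
  lra.
(* For [X >= 0] one divides by [2n - 2 >= 1]; for [X < 0] the right-hand side is already
   nonnegative. *)
have absorb (X S t r rt : R) : 0 <= S -> (2 * n%:R - 2) * X <= C * S + r ->
    r <= C * t -> t <= 3 * rt -> 0 <= t -> X <= 3 * C * (S + rt).
  move=> S0 XS rC trt t0.
  have CS : 0 <= C * S by rewrite mulr_ge0.
  have Ct := ler_wpM2l C0 trt; have Ct0 := mulr_ge0 C0 t0.
  have [X0|X0] := lerP 0 X; last by nra.
  have : X <= (2 * n%:R - 2) * X by rewrite ler_peMl.
  nra.
have pn0 h x : 0 <= pderiv_norm h x :> R by apply: sumr_ge0.
have F0 x : D0 x -> F x = 0.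
  case: scal => scal.
    apply: (eP F) => // [y /DU/bounds[]//|y Dy].
    have Uy := DU y Dy; have [_ Fy] := bounds y Uy.
    have /ler_normlP[_ H] := confC F F_C2 y Dy.
    have := scal c (psi c y) (psi_dom Uy); rewrite scalg// scalgbar// => sle.
    have e1 := expR_gt0 (2 * F y).
    (* Multiplied by [e^(2F)], the curvature inequality bounds [R_gbar - R_g e^(2F)] by
       [R_gbar (1 - e^(2F))], which is of order [|F|]. *)
    have sle' := ler_wpM2r (ltW e1) sle.
    apply: (@absorb _ _ `|expR (2 * F y) - 1| (scalar_curvature_coord G y * (1 - expR (2 * F y)))) => //.
    - by rewrite addr_ge0 ?sqr_ge0.
    - by move: H sle'; lra.
    - apply: le_trans (ler_norm _) _; rewrite normrM distrC ler_wpM2r//.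
      exact: scalC.
  (* For the opposite inequality [-F] is the supersolution: its Hessian term changes sign, its
     gradient norm does not. *)
  have [cN dN ddN] := C2_opp oU F_C2.
  have F0' y : D0 y -> - F y = 0.
    apply: (eP (fun x => - F x)) => //.
    - by move=> z /DU/bounds[]; rewrite normrN.
    - by move=> z Dz ze; rewrite Fout// oppr0.
    move=> z Dz; have Uz := DU z Dz; have [_ Fz] := bounds z Uz.
    have /ler_normlP[H _] := confC F F_C2 z Dz.
    have := scal c (psi c z) (psi_dom Uz); rewrite scalg// scalgbar// => sle.
    have e1 := expR_gt0 (2 * F z).
    have sle' := ler_wpM2r (ltW e1) sle.
    have -> : pderiv_norm (fun x => - F x) z = pderiv_norm F z.
      by apply: eq_bigr => i _; rewrite dN// normrN.
    have -> : \sum_i \sum_j invmx (G z) i j * pderiv i (pderiv j (fun x => - F x)) z =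
        - \sum_i \sum_j invmx (G z) i j * pderiv i (pderiv j F) z.
      rewrite -sumrN; apply: eq_bigr => i _; rewrite -sumrN; apply: eq_bigr => j _.
      by rewrite (ddN i j z Uz) mulrN.
    rewrite normrN.
    apply: (@absorb _ _ `|expR (2 * F z) - 1| (scalar_curvature_coord G z * (expR (2 * F z) - 1))) => //.
    - by rewrite addr_ge0 ?sqr_ge0.
    - by move: H sle'; lra.
    - apply: le_trans (ler_norm _) _; rewrite normrM ler_wpM2r//.
      exact: scalC.
  by move=> /F0' /eqP; rewrite oppr_eq0 => /eqP.
have f0 q : f q = 0.
  have [[dq sq]|] := pselect (dom c q /\ sqnorm (phi c q - x0) < e ^+ 2); last exact: outside.
  have := F0 (phi c q) (eD0 _ (ltW sq)).
  by rewrite /F phiK.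
by move=> c' q dq; rewrite gf// f0 mulr0 expR0 scale1r.
Qed.

End Rigidity.

Unset Implicit Arguments.

Theorem corollary1p6 (R : realType) (n : nat) (hn : (2 <= n)%N)
    (M : smooth_manifold R n) (gbar : riemannian_metric M) (p : M) :
  (exists r0 eta : R, [/\ 0 < r0, 0 < eta &
    forall Omega : set M, domain Omega -> Omega p ->
      Omega `<=` geodesic_ball gbar p r0 ->
      forall g : riemannian_metric M, conformal_class gbar g ->
        tensor_support (tensor_sub g gbar) `<=` Omega ->
        (C0norm gbar (tensor_sub g gbar) < eta%:E)%E ->
        scalar_curvature_le gbar g \/ scalar_curvature_le g gbar ->
        tensor_eq g gbar])
  /\
  (exists2 delta : R, 0 < delta &
    forall Omega : set M, domain Omega -> Omega p ->
      (diameter gbar Omega < delta%:E)%E ->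
      isolated_in_C0 gbar (conformal_solution gbar Omega)).
Proof.
have [r0 r00 rigid] := conformal_rigidity gbar p hn.
have half0 : 0 < 2^-1 :> R by rewrite invr_gt0.
split.
  exists r0, 2^-1; split=> // Omega _ _; exact: rigid.
exists r0 => // Omega _ Op diam.
(* As [p] lies in [Omega], a diameter below [r0] puts [Omega] in the ball; hence [delta] is [r0]. *)
have Or0 : Omega `<=` geodesic_ball gbar p r0.
  move=> q Oq; apply: le_lt_trans diam; apply: ereal_sup_ubound.
  by exists p, q.
split.
  split=> //.
    exists (fun=> 0) => [c|c q _]; first exact: smooth_on_cst.
    by rewrite mulr0 expR0 scale1r.
  have -> : tensor_support (tensor_sub gbar gbar) = set0; last exact: sub0set.
  rewrite /tensor_support (_ : [set q | _] = set0) ?closure0//.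
  by apply/seteqP; split=> // q [c _]; rewrite /tensor_sub subrr.
exists 2^-1 => // g [seq cg supp] small.
by apply: (rigid Omega) => //; left=> c q dq; rewrite seq.
Qed.
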